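(* Let $(g,\nabla)$ be a statistical structure on $M$, let $r>0$, $p\in M$, $\xi\in T_pM$ with $g(\xi,\xi)=r^2$, and $X,Y\in T_pM$. Let $\mathfrak h$ be the second fundamental form of the sphere bundle $S^rM$ in $(TM,\tilde g)$ with respect to the unit normal $\mathcal N_\xi=\frac{1}{\sqrt{r^2+\|K(\xi,\xi)\|^2}}\big(\xi^v_\xi-K(\xi,\xi)^h_\xi\big)$. (a) For every $X,Y$, $$\begin{aligned}\mathfrak h(X^{th}_\xi,Y^{th}_\xi)=\tfrac{1}{\sqrt{r^2+\|K(\xi,\xi)\|^2}}\Big\{&\tfrac12\big[g((\nabla^g_XK)(\xi,\xi),Y)+g((\nabla^g_YK)(\xi,\xi),X)\big]\\&-\tfrac{1}{2r^2}\big[g(K(\xi,\xi),Y)\,g(R(X,K(\xi,\xi))\xi,\xi)+g(K(\xi,\xi),X)\,g(R(Y,K(\xi,\xi))\xi,\xi)\big]\\&-2g(K(\xi,X),K(\xi,Y))\\&+\tfrac1{r^2}g(K(\xi,\xi),X)\,g(K(\xi,\xi),Y)\big(1-\tfrac1{r^2}\|K(\xi,\xi)\|^2\big)\Big\}.\end{aligned}$$ (b) For every $X$ and every $Y\perp\xi$, $$\mathfrak h(X^{th}_\xi,Y^v_\xi)=\tfrac{1}{\sqrt{r^2+\|K(\xi,\xi)\|^2}}\Big[g(K(X,Y),\xi)-\tfrac12g(R(X,K(\xi,\xi))\xi,Y)-\tfrac1{r^2}g(K(\xi,\xi),X)\,g(K(\xi,Y),K(\xi,\xi))\Big].$$ (c)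 For every $X\perp\xi$ and every $Y$, $$\mathfrak h(X^{v}_\xi,Y^{th}_\xi)=\tfrac{1}{\sqrt{r^2+\|K(\xi,\xi)\|^2}}\Big[g(K(X,Y),\xi)-\tfrac12g(R(Y,K(\xi,\xi))\xi,X)-\tfrac1{r^2}g(K(\xi,\xi),Y)\,g(K(\xi,X),K(\xi,\xi))\Big].$$ (d) For every $X,Y\perp\xi$, $$\mathfrak h(X^v_\xi,Y^v_\xi)=\tfrac{1}{\sqrt{r^2+\|K(\xi,\xi)\|^2}}\big[-g(X,Y)-g(K(X,Y),K(\xi,\xi))\big].$$
   Context: All objects are smooth. A statistical structure on a manifold $M$ is a pair $(g,\nabla)$, where $g$ is a (positive definite) Riemannian metric and $\nabla$ is a torsion-free affine connection such that $(\nabla_Xg)(Y,Z)=(\nabla_Yg)(X,Z)$ for all $X,Y,Z$. $\nabla^g$ is the Levi-Civita connection of $g$, $K(X,Y)=K_XY=\nabla_XY-\nabla^g_XY$ (then $g(K(X,Y),Z)$ is totally symmetric), and $R(X,Y)Z=\nabla_X\nabla_YZ-\nabla_Y\nabla_XZ-\nabla_{[X,Y]}Z$ is the curvature tensor of $\nabla$. $\|\cdot\|$ is the norm of $g$. Let $\pi:TM\to M$ be the tangent bundle. For $\xi,X\in T_pM$: the vertical lift $X^v_\xi\in T_\xi TM$ is the velocity at $t=0$ of the curve $t\mapsto \xi+tX$; the horizontal lift $X^h_\xi\in T_\xi TM$ is the velocity at $t=0$ of the curve $t\mapsto\xi_t$ obtained by $\nabla$-parallel transport of $\xi$ along the $\nabla$-geodesic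 with initial velocity $X$. One has $T_\xi TM=\{X^v_\xi\}\oplus\{X^h_\xi\}$. The Sasakian metric $\tilde g$ on $TM$ is given by $\tilde g(X^v,Y^v)=g(X,Y)=\tilde g(X^h,Y^h)$, $\tilde g(X^v,Y^h)=0$; $\nabla^{\tilde g}$ is its Levi-Civita connection. $S^rM=\{\xi\in TM: g(\xi,\xi)=r^2\}$ is a hypersurface of $(TM,\tilde g)$. For $X\in T_{\pi(\xi)}M$ put $X^{th}_\xi=X^h_\xi+\frac1{r^2}g(K(\xi,\xi),X)\,\xi^v_\xi$, which is tangent to $S^rM$ at $\xi$; also $X^v_\xi$ is tangent to $S^rM$ when $X\perp\xi$. The second fundamental form is $\mathfrak h(A,B)=\tilde g(\nabla^{\tilde g}_AB,\mathcal N)=-\tilde g(\nabla^{\tilde g}_A\mathcal N,B)$ for $A,B$ tangent to $S^rM$. *)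

(* Defs.v *)
(* Manifolds are given by an atlas.  The tangent space at [p] is represented,
   through the preferred chart [chart_at p], by the model space [E], so a vector
   field is a function [M -> E].  Functions and fields are total, and "local"
   objects are total ones that are smooth near the point under consideration. *)
From HB Require Import structures.
From mathcomp Require Import all_boot all_order all_algebra.
From mathcomp Require Import all_classical all_reals all_analysis.

Set Implicit Arguments.
Unset Strict Implicit.
Unset Printing Implicit Defensive.

Import Order.TTheory GRing.Theory Num.Theory.
Import numFieldNormedType.Exports.
Local Open Scope classical_set_scope.
Local Open Scope ring_scope.

Section smooth_maps.
Context {R : realType} {V W : normedModType R}.

Fixpoint Ck_on (k : nat) (U : set V) (f : V -> W) : Prop :=
  match k with
  | 0 => forall x, U x -> {for x, continuous f}
  | k'.+1 => (forall x, U x -> differentiable f x) /\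
             (forall v, Ck_on k' U (fun x => 'D_v f x))
  end.

Definition smooth_on (U : set V) (f : V -> W) : Prop := forall k, Ck_on k U f.

Definition smooth_near (f : V -> W) (x : V) : Prop :=
  exists U : set V, [/\ open U, U x & smooth_on U f].

End smooth_maps.

Record charted (R : realType) (E : normedModType R) := Charted {
  carrier :> Type;
  chart : Type;
  chart_dom : chart -> set carrier;
  chart_map : chart -> carrier -> E;
  chart_inv : chart -> E -> carrier;
  chart_at : carrier -> chart }.

Arguments chart_dom {R E M} c : rename.
Arguments chart_map {R E M} c p : rename.
Arguments chart_inv {R E M} c x : rename.
Arguments chart_at {R E M} p : rename.

Section manifolds.
Context {R : realType} {E : normedModType R}.

Definition open_in (M : charted E) (A : set M) : Prop :=
  forall c : chart M, open (chart_map c @` (A `&` chart_dom c)).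

Record is_manifold (M : charted E) : Prop := IsManifold {
  chart_at_dom : forall p : M, chart_dom (chart_at p) p;
  chart_mapK : forall (c : chart M) (p : M),
    chart_dom c p -> chart_inv c (chart_map c p) = p;
  overlap_open : forall c d : chart M,
    open (chart_map c @` (chart_dom c `&` chart_dom d));
  transition_smooth : forall c d : chart M,
    smooth_on (chart_map c @` (chart_dom c `&` chart_dom d))
      (chart_map d \o chart_inv c);
  hausdorff : forall p q : M, p <> q ->
    exists A B : set M, [/\ open_in A, open_in B, A p, B q & A `&` B = set0];
  second_countable_atlas : exists2 C : set (chart M), countable C &
    forall p : M, exists2 c, C c & chart_dom c p }.

Section fields.
Context {M : charted E}.
Implicit Types (p q : M) (v w : E) (X Y Z : M -> E) (f : M -> R).

(* The components in the chart [c] of the tangent vector [v] at [q]. *)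
Definition components (c : chart M) q v : E :=
  'd (chart_map c \o chart_inv (chart_at q)) (chart_map (chart_at q) q) v.

(* The field defined around [p] that has constant components in the chart
   [chart_at p] and takes the value [v] at [p]. *)
Definition const_ext p v : M -> E := fun q =>
  'd (chart_map (chart_at q) \o chart_inv (chart_at p)) (chart_map (chart_at p) q) v.

Definition local_fun p f : E -> R^o := fun x => f (chart_inv (chart_at p) x).

Definition local_field p X : E -> E := fun x =>
  let q := chart_inv (chart_at p) x in components (chart_at p) q (X q).

Definition smooth_fun_at p f : Prop :=
  smooth_near (local_fun p f) (chart_map (chart_at p) p).

Definition smooth_field_at p X : Prop :=
  smooth_near (local_field p X) (chart_map (chart_at p) p).

Definition dirder p v f : R := 'd (local_fun p f) (chart_map (chart_at p) p) v.

Definition lie_bracket X Y : M -> E := fun p =>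
  let x := chart_map (chart_at p) p in
  'd (local_field p Y) x (X p) - 'd (local_field p X) x (Y p).

Definition local_curve (gamma : R -> M) (t : R) : R^o -> E := fun s =>
  chart_map (chart_at (gamma t)) (gamma s).

Definition smooth_curve_at (gamma : R -> M) (t : R) : Prop :=
  (\forall s \near t, chart_dom (chart_at (gamma t)) (gamma s)) /\
  smooth_near (local_curve gamma t) t.

Definition derivable_curve_at (gamma : R -> M) (t : R) : Prop :=
  (\forall s \near t, chart_dom (chart_at (gamma t)) (gamma s)) /\
  derivable (local_curve gamma t) t 1.

Definition velocity (gamma : R -> M) (t : R) : E := 'D_1 (local_curve gamma t) t.

(* For an (embedded) submanifold [S] this is its tangent space at [p]. *)
Definition tangent_to (S : set M) p v : Prop :=
  exists gamma : R -> M, [/\ gamma 0 = p, derivable_curve_at gamma 0,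
    \forall t \near (0 : R), S (gamma t) & velocity gamma 0 = v].

End fields.

Section metrics_connections.
Context {M : charted E}.
Implicit Types (p q : M) (v w : E) (X Y Z : M -> E) (f : M -> R).

Record riemannian_metric (g : M -> E -> E -> R) : Prop := RiemannianMetric {
  metric_linear : forall p (a : R) u v w,
    g p (a *: u + v) w = a * g p u w + g p v w;
  metric_sym : forall p v w, g p v w = g p w v;
  metric_pos : forall p v, v != 0 -> 0 < g p v v;
  metric_smooth : forall p X Y, smooth_field_at p X -> smooth_field_at p Y ->
    smooth_fun_at p (fun q => g q (X q) (Y q)) }.

(* [D p v X] is the covariant derivative at [p] of the field [X] along [v]. *)
Record affine_connection (D : M -> E -> (M -> E) -> E) : Prop := AffineConnection {
  conn_linear : forall p (a : R) v w X, smooth_field_at p X ->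
    D p (a *: v + w) X = a *: D p v X + D p w X;
  conn_add : forall p v X Y, smooth_field_at p X -> smooth_field_at p Y ->
    D p v (fun q => X q + Y q) = D p v X + D p v Y;
  conn_leibniz : forall p v f X, smooth_fun_at p f -> smooth_field_at p X ->
    D p v (fun q => f q *: X q) = dirder p v f *: X p + f p *: D p v X;
  conn_smooth : forall p X Y, smooth_field_at p X -> smooth_field_at p Y ->
    smooth_field_at p (fun q => D q (X q) Y) }.

Definition torsion_free (D : M -> E -> (M -> E) -> E) : Prop :=
  forall p X Y, smooth_field_at p X -> smooth_field_at p Y ->
    D p (X p) Y - D p (Y p) X = lie_bracket X Y p.

(* ((nabla_X g)(Y, Z))(p) *)
Definition nabla_metric (D : M -> E -> (M -> E) -> E) (g : M -> E -> E -> R)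
    X Y Z p : R :=
  dirder p (X p) (fun q => g q (Y q) (Z q))
  - g p (D p (X p) Y) (Z p) - g p (Y p) (D p (X p) Z).

Definition statistical_structure (g : M -> E -> E -> R)
    (D : M -> E -> (M -> E) -> E) : Prop :=
  [/\ riemannian_metric g, affine_connection D, torsion_free D &
   forall p X Y Z, smooth_field_at p X -> smooth_field_at p Y ->
     smooth_field_at p Z -> nabla_metric D g X Y Z p = nabla_metric D g Y X Z p].

Definition levi_civita (g : M -> E -> E -> R)
    (D : M -> E -> (M -> E) -> E) : Prop :=
  [/\ affine_connection D, torsion_free D &
   forall p X Y Z, smooth_field_at p X -> smooth_field_at p Y ->
     smooth_field_at p Z -> nabla_metric D g X Y Z p = 0].

(* The values at [p] of the tensors below are computed on the extensions
   [const_ext p _]; being tensorial, they do not depend on this choice. *)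

Definition curvature (D : M -> E -> (M -> E) -> E) p (x y z : E) : E :=
  let X := const_ext p x in let Y := const_ext p y in let Z := const_ext p z in
  D p x (fun q => D q (Y q) Z) - D p y (fun q => D q (X q) Z)
  - D p (lie_bracket X Y p) Z.

Definition diff_tensor (D Dg : M -> E -> (M -> E) -> E) p (x y : E) : E :=
  D p x (const_ext p y) - Dg p x (const_ext p y).

(* ((Dg_x T)(y, z))(p) for a tensor field [T] of type (1,2) *)
Definition cov_tensor (Dg : M -> E -> (M -> E) -> E) (T : M -> E -> E -> E)
    p (x y z : E) : E :=
  let Y := const_ext p y in let Z := const_ext p z in
  Dg p x (fun q => T q (Y q) (Z q)) - T p (Dg p x Y) z - T p y (Dg p x Z).

Definition metric_norm (g : M -> E -> E -> R) p v : R := Num.sqrt (g p v v).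

(* Covariant derivative at time [t] of the field [V] along the curve [gamma]:
   dV^k/dt + Gamma^k_ij gamma'^i V^j in the chart at [gamma t], the second
   summand being the derivative of the field with constant components. *)
Definition cov_along (D : M -> E -> (M -> E) -> E)
    (gamma : R -> M) (V : R -> E) (t : R) : E :=
  'D_1 (fun s : R^o => components (chart_at (gamma t)) (gamma s) (V s)) t
  + D (gamma t) (velocity gamma t) (const_ext (gamma t) (V t)).

End metrics_connections.
End manifolds.

(* The points of TM are the pairs (p, v) with v in T_pM. *)
Definition tangent_bundle (R : realType) (E : normedModType R) (M : charted E) :
    charted (E * E)%type :=
  @Charted R (E * E)%type (M * E)%type (chart M)
    (fun c => [set eta | chart_dom c eta.1])
    (fun c eta => (chart_map c eta.1, components c eta.1 eta.2))
    (fun c y => let p := chart_inv c y.1 in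
       (p, 'd (chart_map (chart_at p) \o chart_inv c) (y.1) (y.2)))
    (fun eta => chart_at eta.1).

Section bundle.
Context {R : realType} {E : normedModType R} {M : charted E}.
Local Notation TM := (tangent_bundle M).
Implicit Types (eta : TM) (X Y : E) (A B : (E * E)%type).

Definition vertical_lift eta X : (E * E)%type :=
  @velocity R (E * E)%type TM (fun t => (eta.1, eta.2 + t *: X)) 0.

(* [A] is the horizontal lift of [X] at [eta]: [gamma] is the geodesic with
   initial velocity [X], and [V] the parallel transport of [eta] along it. *)
Definition is_horizontal_lift (D : M -> E -> (M -> E) -> E) eta X A : Prop :=
  exists (gamma : R -> M) (V : R -> E),
    let lift : R -> TM := fun t => (gamma t, V t) in
    [/\ lift 0 = eta /\ velocity gamma 0 = X,
        \forall t \near (0 : R), smooth_curve_at lift t,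
        \forall t \near (0 : R), cov_along D gamma (velocity gamma) t = 0,
        \forall t \near (0 : R), cov_along D gamma V t = 0 &
        velocity lift 0 = A].

Definition horizontal_lift (D : M -> E -> (M -> E) -> E)
    (hl : TM -> E -> (E * E)%type) : Prop :=
  forall eta X, is_horizontal_lift D eta X (hl eta X).

Definition sasakian_metric (g : M -> E -> E -> R) (hl : TM -> E -> (E * E)%type)
    (gt : TM -> (E * E)%type -> (E * E)%type -> R) : Prop :=
  riemannian_metric gt /\
  forall eta X Y,
    [/\ gt eta (vertical_lift eta X) (vertical_lift eta Y) = g eta.1 X Y,
        gt eta (hl eta X) (hl eta Y) = g eta.1 X Y &
        gt eta (vertical_lift eta X) (hl eta Y) = 0].

Definition sphere_bundle (g : M -> E -> E -> R) (r : R) : set TM :=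
  [set eta | g eta.1 eta.2 eta.2 = r ^+ 2].

(* [h] is the second fundamental form of the hypersurface [S] with respect to
   the unit normal field [N]. *)
Definition second_fundamental_form (gt : TM -> (E * E)%type -> (E * E)%type -> R)
    (Dt : TM -> (E * E)%type -> (TM -> (E * E)%type) -> (E * E)%type)
    (S : set TM) (N : TM -> (E * E)%type)
    (h : TM -> (E * E)%type -> (E * E)%type -> R) : Prop :=
  forall eta A (B : TM -> (E * E)%type), S eta -> tangent_to S eta A ->
    smooth_field_at eta B ->
    (forall zeta, S zeta -> tangent_to S zeta (B zeta)) ->
    h eta A (B eta) = gt eta (Dt eta A B) (N eta).

Definition sphere_normal (g : M -> E -> E -> R) (K : M -> E -> E -> E)
    (hl : TM -> E -> (E * E)%type) (r : R) eta : (E * E)%type :=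
  let: (p, xi) := eta in
  (Num.sqrt (r ^+ 2 + metric_norm g p (K p xi xi) ^+ 2))^-1 *:
    (vertical_lift eta xi - hl eta (K p xi xi)).

Definition tangential_lift (g : M -> E -> E -> R) (K : M -> E -> E -> E)
    (hl : TM -> E -> (E * E)%type) (r : R) eta X : (E * E)%type :=
  let: (p, xi) := eta in
  hl eta X + (r ^- 2 * g p (K p xi xi) X) *: vertical_lift eta xi.

End bundle.

(* Main.v *)
Require Import Defs.
From HB Require Import structures.
From mathcomp Require Import all_boot all_order all_algebra.
From mathcomp Require Import all_classical all_reals all_analysis.
From mathcomp Require Import ring lra.

(** Put [f(q, v) = g_q(v, v)], so that the sphere bundle is the level set
    [f = r^2].  Half of the gradient of [f] for the Sasakian metric is
    [N0 = xi^v - K(xi, xi)^h], because [nabla g = - 2 K]; hence the second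
    fundamental form is, up to the norm of [N0], minus half of the Hessian of
    [f], and what has to be computed is this Hessian on horizontal and vertical
    vectors.

    The computation takes place in the chart at [p].  There a tangent vector
    [(a, b)] of [TM] at [(x, y)] has horizontal part [a] and vertical part
    [b + Gamma_x(a, y)], where [Gamma] are the Christoffel symbols of [nabla], so
    that the Sasakian metric has coefficients
    [g(a, a') + g(b + Gamma(a, y), b' + Gamma(a', y))] at all points near
    [(p, xi)] ([sasakian_coef]).  The connection of the Sasakian metric on
    coordinate fields then follows from the Koszul formula ([koszul],
    [metric_deriv_sasakian]).

    Coordinate fields are not tangent to the sphere bundle.  From a vector [B]
    that is tangent at [(p, xi)] one gets a tangent field by subtracting
    [(B f / 2 r^2) (0, y)] from the coordinate field: its values are velocities
    of straight lines rescaled to length [r] ([sphere_field_tangent]).  Deriving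
    this correction along [A] adds [- A (B f) / 2] to the inner product with
    [N0] ([conn_sphere_field]).

    What remains is an identity between polynomials in [g], [Gamma], [K] and the
    first derivatives of [Gamma] and [K] at [p] ([second_form_identity]).  It uses
    that [Gamma] and [K] are symmetric, that [g(K(u, v), w)] is totally symmetric
    at all points, hence also its derivative, and that [A (B f) = B (A f)]
    ([derive_swap]).  The last fact is the vanishing of [g(R^g(a, b) xi, xi)] for
    the curvature of the metric, and it is responsible for the symmetrised form
    of the covariant derivative of [K] in the result. *)

Import Order.TTheory GRing.Theory Num.Theory.
Import numFieldNormedType.Exports.
Local Open Scope classical_set_scope.
Local Open Scope ring_scope.

Set Implicit Arguments.
Unset Strict Implicit.

(** * Differentials and smooth maps *)

Section differentials.
Context {R : realType}.
Implicit Types V E W : normedModType R.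

(** Having a given first-order expansion at [x] is a property of the germ at [x]. *)
Lemma near_is_diff V W (f g df : V -> W) (x : V) :
  (\near x, f x = g x) -> is_diff x f df -> is_diff x g df.
Proof.
move=> fg [dfx dfE].
have gE : g \o shift x = cst (g x) + 'd f x +o_ 0 id.
  apply/eqaddoP => _/posnumP[e].
  have /eqaddoP /(_ e%:num [gt0 of e%:num]) := diff_locally dfx.
  have : \forall h \near 0, f (h + x) = g (h + x).
    have := fg; rewrite (near_shift 0 x) subr0 /=; exact.
  rewrite (nbhs_singleton fg).
  apply: filterS2 => h fgh.
  by rewrite !fctE /= fgh.
have dg : 'd g x = 'd f x :> (V -> W).
  by apply: diff_unique gE; exact: diff_continuous.
apply: DiffDef; last by rewrite dg.
by apply/diff_locallyP; rewrite dg; split => //; exact: diff_continuous.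
Qed.

Lemma near_differentiable V W (f g : V -> W) (x : V) :
  (\near x, f x = g x) -> differentiable f x -> differentiable g x.
Proof. by move=> fg /differentiableP /(near_is_diff fg) []. Qed.

Lemma near_diff V W (f g : V -> W) (x : V) :
  (\near x, f x = g x) -> differentiable f x -> 'd g x = 'd f x :> (V -> W).
Proof. by move=> fg /differentiableP /(near_is_diff fg) []. Qed.

Lemma near_is_diff_unique V W (f g df dg : V -> W) (x : V) :
  (\near x, f x = g x) -> is_diff x f df -> is_diff x g dg -> df = dg.
Proof. by move=> fg /(near_is_diff fg) [_ <-] [_ <-]. Qed.

Lemma scale_bilinear W :
  bilinear_for
    (GRing.Scale.Law.clone _ _ *:%R _) (GRing.Scale.Law.clone _ _ *:%R _)
    (@GRing.scale R W : R^o -> W -> W).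
Proof.
split=> [u|u] a x y /=; first by rewrite scalerDl scalerA.
by rewrite scalerDr !scalerA mulrC.
Qed.

HB.instance Definition _ W := bilinear_isBilinear.Build R R^o W W _ _
  (@GRing.scale R W : R^o -> W -> W) (scale_bilinear W).

Lemma is_diffZ_fun V W (s : V -> R^o) (f : V -> W) (ds : V -> R^o)
    (df : V -> W) x :
  is_diff x s ds -> is_diff x f df ->
  is_diff x (fun y => s y *: f y) (fun v => s x *: df v + ds v *: f x).
Proof.
move=> dsx dfx.
have cs : continuous (fun p : R^o * W => p.1 *: p.2).
  by move=> p; apply: (@scale_continuous R W).
have := @diff_bilin _ R^o W W (@GRing.scale R W : R^o -> W -> W) (s x, f x) cs.
have := @differentiable_bilin _ R^o W W (@GRing.scale R W : R^o -> W -> W)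
  (s x, f x) cs.
move=> db dbE.
have bsc : is_diff (s x, f x) (fun p : R^o * W => p.1 *: p.2)
    (fun q : R^o * W => s x *: q.2 + q.1 *: f x) by exact: DiffDef.
have pr := @is_diff_pair _ V R^o W s ds f df x dsx dfx.
exact: (@is_diff_comp _ V (R^o * W)%type W _ _ _ _ x pr bsc).
Qed.

End differentials.

(** The calculus below is done on a normed space with finitely many continuous
    coordinates: this is what makes a differential determined by its partial
    derivatives, and it keeps the representation of the space opaque. *)
Record finite_basis {R : realType} (E : normedModType R) (n : nat) := FiniteBasis {
  basis_vec : 'I_n -> E;
  basis_coord : 'I_n -> E -> R^o;
  basis_coord_linear : forall i, linear (basis_coord i);
  basis_coord_continuous : forall i, continuous (basis_coord i);
  basis_expand : forall v, v = \sum_i basis_coord i v *: basis_vec i }.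

Lemma linear_basis_expand {R : realType} (E : normedModType R) n
    (b : finite_basis E n) (W : lmodType R) (L : E -> W) (a : E) : linear L ->
  L a = \sum_i basis_coord b i a *: L (basis_vec b i).
Proof.
move=> linL; pose aL := GRing.isLinear.Build _ _ _ _ _ linL.
pose pL : {linear _ -> _} := HB.pack L aL.
rewrite -[L]/(pL : _ -> _) {1}[a](basis_expand b) linear_sum.
by apply: eq_bigr => i _; rewrite linearZ.
Qed.

Section smoothness.
Context {R : realType}.
Implicit Types V E W : normedModType R.

Lemma eq_Ck_on V W k (U : set V) (f g : V -> W) : open U ->
  (forall x, U x -> f x = g x) -> Ck_on k U f -> Ck_on k U g.
Proof.
move=> oU; elim: k f g => [|k IH] f g fg.
  move=> cf x Ux; suff : g @ x --> f x by rewrite (fg x Ux).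
  apply: cvg_trans (cf x Ux); apply: near_eq_cvg.
  by have := open_nbhs_nbhs (conj oU Ux); apply: filterS => y /fg.
have nfg x : U x -> \near x, f x = g x.
  by move=> Ux; have := open_nbhs_nbhs (conj oU Ux); apply: filterS => y /fg.
move=> [df Df]; split=> [x Ux|v].
  by apply: near_differentiable (nfg x Ux) (df x Ux).
by apply: IH (Df v) => x Ux; apply: near_eq_derive; exact: nfg.
Qed.

Lemma Ck_on_subset V W k (U U' : set V) (f : V -> W) :
  U' `<=` U -> Ck_on k U f -> Ck_on k U' f.
Proof.
move=> UU'; elim: k f => [|k IH] f /=; first by move=> cf x /UU'/cf.
by move=> [df Df]; split=> [x /UU'/df//|v]; exact: IH.
Qed.

Lemma Ck_onW V W k (U : set V) (f : V -> W) : Ck_on k.+1 U f -> Ck_on k U f.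
Proof.
elim: k f => [|k IH] f; first by move=> [df _] x /df/differentiable_continuous.
by move=> [df Df]; split=> // v; exact: IH.
Qed.

Lemma Ck_on_cst V W k (U : set V) (w : W) : Ck_on k U (fun=> w).
Proof.
elim: k w => [|k IH] w; first by move=> x _; exact: cst_continuous.
split=> [x _|v]; first exact: differentiable_cst.
rewrite [X in Ck_on _ _ X](_ : _ = (fun=> 0)); first exact: IH.
by apply/funext => x; exact: derive_cst.
Qed.

Lemma Ck_onD V W k (U : set V) (f g : V -> W) : open U ->
  Ck_on k U f -> Ck_on k U g -> Ck_on k U (fun x => f x + g x).
Proof.
move=> oU; elim: k f g => [|k IH] f g /=.
  by move=> cf cg x Ux; apply: cvgD; [exact: cf|exact: cg].
move=> [df Df] [dg Dg]; split=> [x Ux|v].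
  by apply: differentiableD; [exact: df|exact: dg].
apply: eq_Ck_on (IH _ _ (Df v) (Dg v)) => // x Ux.
by rewrite -deriveD; [|apply: diff_derivable; exact: df
  |apply: diff_derivable; exact: dg].
Qed.

Lemma Ck_onZ V W k (U : set V) (s : V -> R^o) (f : V -> W) : open U ->
  Ck_on k U s -> Ck_on k U f -> Ck_on k U (fun x => s x *: f x).
Proof.
move=> oU; elim: k s f => [|k IH] s f.
  by move=> cs cf x Ux; apply: cvgZ; [exact: cs|exact: cf].
move=> Cs Cf; have [ds Ds] := Cs; have [df Df] := Cf.
have dsf x : U x -> is_diff x (fun y => s y *: f y)
    (fun v => s x *: 'd f x v + 'd s x v *: f x).
  by move=> Ux; apply: is_diffZ_fun; apply: differentiableP; [exact: ds|exact: df].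
split=> [x /dsf [] //|v].
apply: eq_Ck_on (Ck_onD oU (IH _ _ (Ck_onW Cs) (Df v))
  (IH _ _ (Ds v) (Ck_onW Cf))) => // x Ux.
have [dsfx dE] := dsf x Ux.
rewrite (deriveE _ (df x Ux)) (deriveE _ (ds x Ux)) (deriveE _ dsfx).
exact: (esym (congr1 (fun F => F v) dE)).
Qed.

Lemma is_diff_linear V W (L : V -> W) x :
  linear L -> continuous L -> is_diff x L L.
Proof.
move=> linL cL.
pose aL := GRing.isLinear.Build _ _ _ _ _ linL.
pose pL : {linear _ -> _} := HB.pack L aL.
apply: DiffDef; first exact: (@linear_differentiable _ _ _ pL).
exact: (@diff_lin _ _ _ pL).
Qed.

Lemma Ck_on_linear_comp V W (W' : normedModType R) k (U : set V)
    (L : W -> W') (f : V -> W) : open U -> linear L -> continuous L ->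
  Ck_on k U f -> Ck_on k U (fun x => L (f x)).
Proof.
move=> oU linL cL; elim: k f => [|k IH] f.
  by move=> cf x Ux; apply: continuous_comp; [exact: cf|exact: cL].
move=> [df Df].
have dLf x : U x -> is_diff x (L \o f) (L \o 'd f x).
  move=> Ux; apply: is_diff_comp; first exact/differentiableP/df.
  exact: is_diff_linear.
split=> [x /dLf[]//|v].
apply: eq_Ck_on (IH _ (Df v)) => // x Ux.
have [dL dLE] := dLf x Ux.
by rewrite [RHS]deriveE // dLE /= deriveE //; exact: df.
Qed.

Lemma is_diff_line V (x v : V) (t : R^o) :
  is_diff t (fun s : R^o => x + s *: v) (fun s => s *: v).
Proof.
have H := @is_diffZ_fun _ R^o V _ _ _ _ _ (is_diff_id t) (is_diff_cst v t).
apply: (is_diff_eq (is_diffD (is_diff_cst x t) H)).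
by apply/funext => s /=; rewrite !fctE /= scaler0 !add0r.
Qed.

Lemma smooth_on_linear V W (U : set V) (L : V -> W) :
  linear L -> continuous L -> smooth_on U L.
Proof.
move=> linL cL [|k]; first by move=> x _; exact: cL.
split=> [x _|v]; first by case: (is_diff_linear x linL cL).
rewrite [X in Ck_on _ _ X](_ : _ = (fun=> L v)); first exact: Ck_on_cst.
by apply/funext => x; have [d dE] := is_diff_linear x linL cL;
  rewrite deriveE // dE.
Qed.

Lemma Ck_on_sum V W n k (U : set V) (f : 'I_n -> V -> W) : open U ->
  (forall i, Ck_on k U (f i)) -> Ck_on k U (fun x => \sum_i f i x).
Proof.
move=> oU Cf.
have -> : (fun x => \sum_i f i x) = \sum_i (f i).
  by apply/funext => x; rewrite fct_sumE.
elim/big_ind: _ => [|g h Cg Ch|i _]; [exact: Ck_on_cst|exact: Ck_onD|exact: Cf].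
Qed.

(** Along [v], the composite has derivative the sum of the partial derivatives of
    [f] at [s x] weighted by the coordinates of ['D_v s]: each term is a product
    of maps of lower order, which closes the induction on [k]. *)
Lemma Ck_on_comp V E W n (b : finite_basis E n) k (U : set V) (U' : set E)
    (s : V -> E) (f : E -> W) : open U -> (forall x, U x -> U' (s x)) ->
  Ck_on k U s -> Ck_on k U' f -> Ck_on k U (fun x => f (s x)).
Proof.
move=> oU sU; elim: k f => [|k IH] f.
  by move=> cs cf x Ux; apply: continuous_comp; [exact: cs|exact/cf/sU].
move=> Cs Cf; have [ds Ds] := Cs; have [df Df] := Cf.
have dfs x : U x -> is_diff x (f \o s) ('d f (s x) \o 'd s x).
  by move=> Ux; apply: is_diff_comp; apply/differentiableP; [exact: ds|exact/df/sU].
split=> [x /dfs[]//|v].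
have C : Ck_on k U
    (fun x => \sum_i basis_coord b i ('D_v s x) *: 'D_(basis_vec b i) f (s x)).
  apply: Ck_on_sum => // i; apply: Ck_onZ => //.
    apply: (Ck_on_linear_comp oU (@basis_coord_linear _ _ _ b i)) => //.
      exact: basis_coord_continuous.
    exact: Ds.
  exact: (IH ('D_(basis_vec b i) f)) (Ck_onW Cs) (Df _).
apply: eq_Ck_on C => // x Ux.
have [dL dLE] := dfs x Ux.
rewrite [RHS]deriveE // dLE /=.
rewrite [RHS](linear_basis_expand b ('d s x v) (linearP ('d f (s x)))).
apply: eq_bigr => i _.
by rewrite !deriveE //; first [exact: ds|exact/df/sU].
Qed.

Lemma smooth_near_is_near V W (f : V -> W) x :
  smooth_near f x -> \near x, smooth_near f x.
Proof.
move=> [U [oU Ux sf]].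
by have := open_nbhs_nbhs (conj oU Ux); apply: filterS => y Uy; exists U.
Qed.

Lemma eq_smooth_near V W (f g : V -> W) x :
  (\near x, f x = g x) -> smooth_near f x -> smooth_near g x.
Proof.
rewrite {1}/prop_near1 nbhsE => [[A [oA Ax] Afg]] [U [oU Ux sf]].
exists (A `&` U); split => //; first exact: openI.
move=> k; apply: (@eq_Ck_on _ _ _ _ f); first exact: openI.
  by move=> y [/Afg].
by apply: Ck_on_subset (sf k) => y [].
Qed.

Lemma smooth_near_differentiable V W (f : V -> W) x :
  smooth_near f x -> differentiable f x.
Proof. by move=> [U [_ Ux sf]]; have [df _] := sf 1%N; exact: df. Qed.

Lemma smooth_near_derive V W (f : V -> W) x v :
  smooth_near f x -> smooth_near ('D_v f) x.
Proof. by move=> [U [? ? sf]]; exists U; split => // k; have [_] := sf k.+1; exact. Qed.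

Lemma smooth_near_cst V W (w : W) (x : V) : smooth_near (fun=> w) x.
Proof.
exists setT; split => //; first exact: openT.
by move=> k; exact: Ck_on_cst.
Qed.

Lemma smooth_near_linear V W (L : V -> W) x :
  linear L -> continuous L -> smooth_near L x.
Proof.
move=> lL cL; exists setT; split=> //; first exact: openT.
exact: smooth_on_linear.
Qed.

Lemma smooth_nearD V W (f g : V -> W) x :
  smooth_near f x -> smooth_near g x -> smooth_near (fun y => f y + g y) x.
Proof.
move=> [U [oU Ux sf]] [U' [oU' Ux' sg]]; exists (U `&` U'); split=> //.
  exact: openI.
move=> k; apply: Ck_onD; first exact: openI.
  by apply: Ck_on_subset (sf k) => y [].
by apply: Ck_on_subset (sg k) => y [].
Qed.

Lemma smooth_nearZ V W (s : V -> R^o) (f : V -> W) x :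
  smooth_near s x -> smooth_near f x -> smooth_near (fun y => s y *: f y) x.
Proof.
move=> [U [oU Ux sf]] [U' [oU' Ux' sg]]; exists (U `&` U'); split=> //.
  exact: openI.
move=> k; apply: Ck_onZ; first exact: openI.
  by apply: Ck_on_subset (sf k) => y [].
by apply: Ck_on_subset (sg k) => y [].
Qed.

Lemma smooth_near_sum V W n (f : 'I_n -> V -> W) x :
  (forall i, smooth_near (f i) x) -> smooth_near (fun y => \sum_i f i y) x.
Proof.
move=> sf.
have -> : (fun x => \sum_i f i x) = \sum_i (f i).
  by apply/funext => y; rewrite fct_sumE.
elim/big_ind: _ => [|g h Cg Ch|i _].
- exact: smooth_near_cst.
- exact: smooth_nearD.
- exact: sf.
Qed.

Lemma smooth_near_linear_comp V W (W' : normedModType R) (L : W -> W')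
    (f : V -> W) x : linear L -> continuous L ->
  smooth_near f x -> smooth_near (fun y => L (f y)) x.
Proof.
move=> lL cL [U [oU Ux sf]]; exists U; split=> // k.
exact: Ck_on_linear_comp.
Qed.

Lemma smooth_near_comp V E W n (b : finite_basis E n) (s : V -> E) (f : E -> W) x :
  smooth_near s x -> smooth_near f (s x) -> smooth_near (fun y => f (s y)) x.
Proof.
move=> ss [U [oU Ux sf]].
have : \near x, U (s x).
  have := differentiable_continuous (smooth_near_differentiable ss).
  by apply; exact: open_nbhs_nbhs.
rewrite {1}/prop_near1 nbhsE => [[A [oA Ax] AU]].
have [U' [oU' Ux' sfs]] := ss.
exists (A `&` U'); split=> //; first exact: openI.
move=> k; apply: (@Ck_on_comp _ _ _ _ b _ _ U); first exact: openI.
- by move=> y [/AU].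
- by apply: Ck_on_subset (sfs k) => y [].
- exact: sf.
Qed.

End smoothness.
Section products.
Context {R : realType} {V W : normedModType R}.

Lemma near_fst (z : V * W) (P : V -> Prop) :
  (\forall x \near z.1, P x) -> \forall y \near z, P y.1.
Proof.
move=> nP; exists (P, setT) => [|y [] //].
by split => //; exact: filterT.
Qed.

Lemma fst_linear : linear (fst : V * W -> V). Proof. by []. Qed.
Lemma snd_linear : linear (snd : V * W -> W). Proof. by []. Qed.

Lemma fst_continuous : continuous (fst : V * W -> V).
Proof. by move=> z A nA; exact: near_fst nA. Qed.
Lemma snd_continuous : continuous (snd : V * W -> W).
Proof. by move=> z A nA; exists (setT, A) => [|y []//]; split => //; exact: filterT. Qed.

Lemma is_diff_fst (z : V * W) : is_diff z fst fst.
Proof. exact: is_diff_linear fst_linear fst_continuous. Qed.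
Lemma is_diff_snd (z : V * W) : is_diff z snd snd.
Proof. exact: is_diff_linear snd_linear snd_continuous. Qed.

End products.

Section linear_families.
Context {R : realType}.
Implicit Types V E W : normedModType R.

(** Chain rule for an expression in which the linear argument [u] varies with the
    point as well.  Expanding [u] in the basis reduces it to the product rule.
    It is applied to metric coefficients, Christoffel symbols and derivatives
    of transition maps. *)
Lemma is_diff_linear_family V E W n (b : finite_basis E n) (L : E -> V -> W) (u du : V -> E) z :
  (\forall y \near z, forall a, L a y = \sum_i basis_coord b i a *: L (basis_vec b i) y) ->
  (forall i, differentiable (L (basis_vec b i)) z) ->
  is_diff z u du ->
  is_diff z (fun y => L (u y) y) (fun v => 'd (L (u z)) z v + L (du v) z).
Proof.
move=> LE dL du'.
have sumE (s : 'I_n -> V -> R^o) (ds : 'I_n -> V -> R^o) :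
    (forall i, is_diff z (s i) (ds i)) ->
    is_diff z (fun y => \sum_i s i y *: L (basis_vec b i) y)
      (fun v => \sum_i (s i z *: 'd (L (basis_vec b i)) z v
                        + ds i v *: L (basis_vec b i) z)).
  move=> hs.
  have -> : (fun y => \sum_i s i y *: L (basis_vec b i) y) =
      \sum_i (fun y => s i y *: L (basis_vec b i) y).
    by apply/funext => y; rewrite fct_sumE.
  have -> : (fun v => \sum_i (s i z *: 'd (L (basis_vec b i)) z v
                        + ds i v *: L (basis_vec b i) z)) =
      \sum_i (fun v => s i z *: 'd (L (basis_vec b i)) z v
                        + ds i v *: L (basis_vec b i) z).
    by apply/funext => y; rewrite fct_sumE.
  elim/big_ind2: _ => [|f1 g1 f2 g2 h1 h2|i _].
  - exact: is_diff_cst.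
  - exact: is_diffD.
  - exact: (is_diffZ_fun (hs i) (differentiableP (dL i))).
have dLa a : 'd (L a) z = (fun v => \sum_i basis_coord b i a *: 'd (L (basis_vec b i)) z v)
    :> (V -> W).
  have [_ /= H] := sumE (fun i _ => basis_coord b i a) (fun _ => cst 0) (fun i => is_diff_cst _ _).
  have -> : 'd (L a) z = 'd (fun y => \sum_i basis_coord b i a *: L (basis_vec b i) y) z :> (V -> W).
    apply: near_diff; first by apply: filterS LE => y ->.
    by case: (sumE (fun i _ => basis_coord b i a) (fun _ => cst 0) (fun i => is_diff_cst _ _)).
  by rewrite H; apply/funext => v; apply: eq_bigr => i _; rewrite scale0r addr0.
have hu i : is_diff z (fun y => basis_coord b i (u y) : R^o) (fun v => basis_coord b i (du v)).
  have dc := is_diff_linear (u z) (basis_coord_linear b i) (@basis_coord_continuous _ _ _ b i).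
  exact: (is_diff_comp du' dc).
apply: (@near_is_diff _ _ _ (fun y => \sum_i basis_coord b i (u y) *: L (basis_vec b i) y)).
  by apply: filterS LE => y ->.
have H := sumE _ _ hu; apply: (is_diff_eq H).
apply/funext => v; rewrite dLa (nbhs_singleton LE (du v)) big_split /=.
by [].
Qed.

End linear_families.

(** The factor that rescales a vector with squared length [h] to length [r]. *)
Lemma is_diff_normalize {R : realType} (r : R) (h dh : R^o -> R^o) (t : R^o) :
  0 < r -> h t = r ^+ 2 -> is_diff t h dh ->
  is_diff t (fun s => r / Num.sqrt (h s) : R^o)
    (fun s => - (2 * r ^+ 2)^-1 * dh s).
Proof.
move=> r0 ht hh.
have r2 : 0 < r ^+ 2 by rewrite exprn_gt0.
have sr : Num.sqrt (r ^+ 2) = r by rewrite sqrtr_sqr gtr0_norm.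
have rn0 : r != 0 by rewrite gt_eqF.
have H : is_diff (h t) (fun y : R^o => r / Num.sqrt y : R^o)
    (fun s => - (2 * r ^+ 2)^-1 * s).
  rewrite ht.
  have ds : is_derive (r ^+ 2) 1 (fun y : R => (Num.sqrt y)^-1)
      (- (Num.sqrt (r ^+ 2)) ^- 2 *: (2 * Num.sqrt (r ^+ 2))^-1).
    by apply: is_deriveV; [rewrite sr|exact: is_derive1_sqrt].
  have [d dE] := is_deriveZ r ds.
  have dd : differentiable (r *: (fun y : R => (Num.sqrt y)^-1)) (r ^+ 2).
    exact/derivable1_diffP.
  apply: (is_diff_eq (differentiableP dd)).
  apply/funext => s; rewrite diff1E // derive1E dE sr.
  rewrite /GRing.scale /=.
  by field.
exact: (is_diff_comp hh H).
Qed.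

(** * Symmetry of second derivatives *)

Section schwarz.
Context {R : realType} {V : normedModType R}.

Lemma is_derive_line (F : V -> R^o) (x v : V) (t : R) :
  differentiable F (x + t *: v) ->
  is_derive (t : R^o) 1 (fun s : R^o => F (x + s *: v)) ('D_v F (x + t *: v)).
Proof.
move=> dF.
have [d dE] := is_diff_comp (is_diff_line x v (t : R^o)) (differentiableP dF).
apply: DeriveDef; first exact: diff_derivable.
transitivity ('d (F \o (fun s : R^o => x + s *: v)) (t : R^o) 1).
  by rewrite -deriveE.
by rewrite dE /= scale1r deriveE.
Qed.

Lemma line_increment (f df : R^o -> R^o) (h : R) : 0 < h ->
  (forall t : R, 0 <= t <= h -> is_derive (t : R^o) 1 f (df t)) ->
  exists2 t : R, 0 <= t <= h & f h - f 0 = df t * h.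
Proof.
move=> h0 hf.
have [||c] := @MVT R f df 0 h h0.
- move=> t; rewrite in_itv /= => /andP[t0 th]; apply: hf.
  by rewrite !ltW.
- apply: (@derivable_within_continuous R _ f) => t; rewrite in_itv /= => th.
  by case: (hf t th).
rewrite in_itv /= subr0 => /andP[c0 ch] E; exists c => //.
by rewrite !ltW.
Qed.

(** The mean value theorem in the direction [u], for an increment of [F] along
    [v], and then in the direction [v], for ['D_u F]. *)
Lemma double_increment (F : V -> R^o) (x u v : V) (h : R) : 0 < h ->
  (forall s t : R, 0 <= s <= h -> 0 <= t <= h ->
    differentiable F (x + s *: u + t *: v) /\
    differentiable ('D_u F) (x + s *: u + t *: v)) ->
  exists s t : R, [/\ 0 <= s <= h, 0 <= t <= h &
    F (x + h *: u + h *: v) - F (x + h *: u) - (F (x + h *: v) - F x) =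
    'D_v ('D_u F) (x + s *: u + t *: v) * h * h].
Proof.
move=> h0 dF.
have hh : 0 <= h <= h by rewrite (ltW h0) lexx.
have zh : 0 <= (0 : R) <= h by rewrite lexx (ltW h0).
have du (s t : R) : 0 <= s <= h -> 0 <= t <= h ->
    is_derive (s : R^o) 1 (fun s : R^o => F (x + s *: u + t *: v))
      ('D_u F (x + s *: u + t *: v)).
  move=> sh th; have [dFst _] := dF s t sh th.
  have := @is_derive_line F (x + t *: v) u s.
  rewrite addrAC => /(_ dFst).
  rewrite (_ : (fun s : R^o => F (x + t *: v + s *: u)) =
    (fun s : R^o => F (x + s *: u + t *: v))) //.
  by apply/funext => s'; rewrite addrAC.
have [|s sh sE] := @line_increment
    (fun s => F (x + s *: u + h *: v) - F (x + s *: u + (0 : R) *: v))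
    (fun s => 'D_u F (x + s *: u + h *: v) - 'D_u F (x + s *: u + (0 : R) *: v)) h h0.
  by move=> s sh; apply: is_deriveB; apply: du.
have [|t th tE] := @line_increment (fun t => 'D_u F (x + s *: u + t *: v))
    (fun t => 'D_v ('D_u F) (x + s *: u + t *: v)) h h0.
  by move=> t th; apply: is_derive_line; case: (dF s t sh th).
exists s, t; split => //.
by rewrite tE !scale0r !addr0 in sE.
Qed.

(** The second difference of [F] over a small parallelogram is symmetric in [u]
    and [v], while [double_increment] evaluates it through either mixed
    derivative at a nearby point; continuity of both derivatives concludes. *)
Lemma derive_swap (F : V -> R^o) (x u v : V) : smooth_near F x ->
  'D_u ('D_v F) x = 'D_v ('D_u F) x.
Proof.
move=> sF; set P := 'D_u ('D_v F); set Q := 'D_v ('D_u F).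
have cont G : smooth_near G x -> {for x, continuous (G : V -> R^o)}.
  by move=> /smooth_near_differentiable/differentiable_continuous.
have cP := cont P (smooth_near_derive _ (smooth_near_derive _ sF)).
have cQ := cont Q (smooth_near_derive _ (smooth_near_derive _ sF)).
apply/eqP; rewrite -subr_eq0 -normr_le0; apply/ler_addgt0Pr => e e0; rewrite add0r.
have e20 : 0 < e / 2 by rewrite divr_gt0.
have nP : \forall y \near x, `|P x - P y| < e / 2.
  by move/cvgrPdist_lt: cP => /(_ _ e20).
have nQ : \forall y \near x, `|Q x - Q y| < e / 2.
  by move/cvgrPdist_lt: cQ => /(_ _ e20).
have nF w : \forall y \near x, differentiable F y /\ differentiable ('D_w F) y.
  have := smooth_near_is_near sF; apply: filterS => y sy.
  by split; apply: smooth_near_differentiable => //; exact: smooth_near_derive.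
pose L (z : R^o * R^o) := x + z.1 *: u + z.2 *: v.
have cL : {for (0 : (R^o * R^o)%type), continuous L}.
  apply: differentiable_continuous.
  have d1 := is_diffZ_fun (is_diff_fst (0 : (R^o * R^o)%type)) (is_diff_cst u _).
  have d2 := is_diffZ_fun (is_diff_snd (0 : (R^o * R^o)%type)) (is_diff_cst v _).
  by have [] := is_diffD (is_diffD (is_diff_cst x _) d1) d2.
have L0 : L 0 = x by rewrite /L !scale0r !addr0.
have nL : \forall y \near L 0, [/\ `|P x - P y| < e / 2, `|Q x - Q y| < e / 2,
    differentiable F y /\ differentiable ('D_u F) y &
    differentiable F y /\ differentiable ('D_v F) y].
  rewrite L0; apply: filterS (filterI (filterI nP nQ) (filterI (nF u) (nF v))).
  by move=> y [[? ?] [? ?]].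
have /nbhs_ballP[d /= d0 dL] := cL _ nL.
have h0 : 0 < d / 2 by rewrite divr_gt0.
have good (s t : R) : 0 <= s <= d / 2 -> 0 <= t <= d / 2 ->
    [/\ `|P x - P (L (s, t))| < e / 2, `|Q x - Q (L (s, t))| < e / 2,
    differentiable F (L (s, t)) /\ differentiable ('D_u F) (L (s, t)) &
    differentiable F (L (s, t)) /\ differentiable ('D_v F) (L (s, t))].
  have small (a : R) : 0 <= a <= d / 2 -> `|0 - a| < d.
    move=> /andP[a0 ad]; rewrite sub0r normrN ger0_norm //.
    by apply: le_lt_trans ad _; rewrite ltr_pdivrMr // ltr_pMr // ltr1n.
  by move=> sh th; apply: dL; split; apply: small.
have [s [t [sh th stE]]] := @double_increment F x u v _ h0
  (fun s t sh th => let: And4 _ _ H _ := good s t sh th in H).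
have [|t' [s' [th' sh' stE']]] := @double_increment F x v u _ h0.
  by move=> t' s' th' sh'; rewrite addrAC; have [] := good s' t' sh' th'.
have PQ : Q (L (s, t)) = P (L (s', t')).
  have hn0 : d / 2 != 0 by rewrite gt_eqF.
  apply: (mulIf hn0); apply: (mulIf hn0).
  have L' : x + t' *: v + s' *: u = L (s', t') by rewrite /L addrAC.
  rewrite L' (addrAC x) in stE'.
  rewrite -[LHS]stE -[RHS]stE'; ring.
have [p1 _ _ _] := good s' t' sh' th'.
have [_ q1 _ _] := good s t sh th.
rewrite -PQ in p1.
have -> : P x - Q x = (P x - Q (L (s, t))) - (Q x - Q (L (s, t)))
  by rewrite opprB addrA subrK.
rewrite (splitr e); apply: le_trans (ler_normB _ _) _.
exact: (lerD (ltW p1) (ltW q1)).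
Qed.

End schwarz.

(** * Atlases and coordinate fields *)

Section atlas.
Context {R : realType} {E : normedModType R}.

Local Notation transition c d := (chart_map d \o chart_inv c).

(** The part of the notion of manifold that suffices for tangent vectors, germs
    of fields and first derivatives.  It is also satisfied by the tangent bundle
    of a manifold, so that the lemmas on connections and on the Koszul formula
    apply to [M] and to [TM]. *)
Record differentiable_atlas (M : charted E) : Prop := DifferentiableAtlas {
  atlas_chart_at : forall p : M, chart_dom (chart_at p) p;
  atlas_mapK : forall (c : chart M) (p : M),
    chart_dom c p -> chart_inv c (chart_map c p) = p;
  atlas_overlap : forall c d : chart M,
    open (chart_map c @` (chart_dom c `&` chart_dom d));
  atlas_transition : forall (c d : chart M) (p : M),
    chart_dom c p -> chart_dom d p ->
    differentiable (transition c d) (chart_map c p) }.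

Context {M : charted E} (hM : differentiable_atlas M).
Implicit Types (p q : M) (c d e : chart M).

Lemma near_overlap c d p : chart_dom c p -> chart_dom d p ->
  \forall x \near chart_map c p,
    [/\ chart_dom c (chart_inv c x), chart_dom d (chart_inv c x) &
        chart_map c (chart_inv c x) = x].
Proof.
move=> cp dp; have : (chart_map c @` (chart_dom c `&` chart_dom d)) (chart_map c p).
  by exists p.
move=> /(conj (atlas_overlap hM c d))/open_nbhs_nbhs; apply: filterS.
by move=> _ [q [cq dq] <-]; rewrite (atlas_mapK hM).
Qed.

Lemma near_chart c p : chart_dom c p ->
  \forall x \near chart_map c p,
    chart_dom c (chart_inv c x) /\ chart_map c (chart_inv c x) = x.
Proof. by move=> cp; have := near_overlap cp cp; apply: filterS => x []. Qed.

Lemma transition_cocycle c d e p v :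
  chart_dom c p -> chart_dom d p -> chart_dom e p ->
  'd (transition d e) (chart_map d p) ('d (transition c d) (chart_map c p) v) =
  'd (transition c e) (chart_map c p) v.
Proof.
move=> cp dp ep.
have dcd := atlas_transition hM cp dp.
have tE : transition c d (chart_map c p) = chart_map d p.
  by rewrite /= (atlas_mapK hM).
have dde : differentiable (transition d e) (transition c d (chart_map c p)).
  by rewrite tE; exact: atlas_transition.
have H := diff_comp dcd dde; rewrite -tE.
have nn : \forall x \near chart_map c p,
    transition c e x = (transition d e \o transition c d) x.
  apply: filterS (near_overlap cp dp) => x [cx dx xE] /=.
  by rewrite (atlas_mapK hM).
have H' := near_diff nn (atlas_transition hM cp ep).
exact: (congr1 (fun F => F v) (etrans (esym H) H')).
Qed.

Lemma transition_id c p v : chart_dom c p ->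
  'd (transition c c) (chart_map c p) v = v.
Proof.
move=> cp; have [_ idE] := is_diff_id (chart_map c p).
have H : 'd (transition c c) (chart_map c p) = 'd id (chart_map c p) :> (E -> E).
  apply: near_diff => //; have := near_chart cp.
  by apply: filterS => x [_ /= ->].
by rewrite H idE.
Qed.

Lemma components_const_ext p q v : chart_dom (chart_at p) q ->
  components (chart_at p) q (const_ext p v q) = v.
Proof.
move=> pq; rewrite /components /const_ext transition_cocycle //.
  exact: transition_id.
exact: atlas_chart_at.
Qed.

Lemma const_ext_components p q v : chart_dom (chart_at p) q ->
  const_ext p (components (chart_at p) q v) q = v.
Proof.
move=> pq; rewrite /components /const_ext transition_cocycle //;
  try exact: atlas_chart_at.
exact/transition_id/atlas_chart_at.
Qed.

Lemma components_chart_at p v : components (chart_at p) p v = v.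
Proof. exact/transition_id/atlas_chart_at. Qed.

Lemma const_ext_self p v : const_ext p v p = v.
Proof. exact/transition_id/atlas_chart_at. Qed.

Lemma chart_inv_at p : chart_inv (chart_at p) (chart_map (chart_at p) p) = p.
Proof. exact/atlas_mapK/atlas_chart_at. Qed.

Lemma local_field_at p X : local_field p X (chart_map (chart_at p) p) = X p.
Proof. by rewrite /local_field chart_inv_at components_chart_at. Qed.

Lemma near_chart_at p : \forall x \near chart_map (chart_at p) p,
    chart_dom (chart_at p) (chart_inv (chart_at p) x) /\
    chart_map (chart_at p) (chart_inv (chart_at p) x) = x.
Proof. exact/near_chart/atlas_chart_at. Qed.

Lemma local_field_const_ext p v :
  \forall x \near chart_map (chart_at p) p, local_field p (const_ext p v) x = v.
Proof.
by have := near_chart_at p; apply: filterS => x [px _];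
  rewrite /local_field components_const_ext.
Qed.

Lemma smooth_const_ext p v : smooth_field_at p (const_ext p v).
Proof.
apply: (@eq_smooth_near _ _ _ (fun=> v)); last exact: smooth_near_cst.
by have := local_field_const_ext p v; apply: filterS.
Qed.

(** In the chart at another point [q], the field [const_ext p v] has components
    that vary with the point; their derivative is the second-order term of the
    transformation law of the Christoffel symbols. *)
Lemma local_field_const_ext_chart p q v : chart_dom (chart_at p) q ->
  let c := chart_at p in let d := chart_at q in
  \forall z \near chart_map d q,
    local_field q (const_ext p v) z = 'd (transition c d) (transition d c z) v.
Proof.
move=> cq c d; have := near_overlap (atlas_chart_at hM q) cq.
apply: filterS => z [dz cz zE].
rewrite /local_field /components /const_ext transition_cocycle //.
exact: atlas_chart_at.
Qed.

Lemma lie_bracket_const_ext p v w :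
  lie_bracket (const_ext p v) (const_ext p w) p = 0.
Proof.
have dl u : 'd (local_field p (const_ext p u)) (chart_map (chart_at p) p)
    = (fun=> 0) :> (E -> E).
  have := @near_diff _ _ _ (cst u) (local_field p (const_ext p u))
    (chart_map (chart_at p) p).
  rewrite diff_cst; apply; last exact: differentiable_cst.
  by have := local_field_const_ext p u; apply: filterS.
by rewrite /lie_bracket !dl subr0.
Qed.

Lemma dirder_chart p q w (F : M -> R) : chart_dom (chart_at p) q ->
  differentiable (local_fun p F) (chart_map (chart_at p) q) ->
  dirder q w F =
  'd (local_fun p F) (chart_map (chart_at p) q) (components (chart_at p) q w).
Proof.
move=> cq dF; rewrite /dirder /components.
have dq := atlas_chart_at hM q.
have dt := atlas_transition hM dq cq.
have tE : transition (chart_at q) (chart_at p) (chart_map (chart_at q) q) =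
    chart_map (chart_at p) q by rewrite /= (atlas_mapK hM).
have dF' : differentiable (local_fun p F)
    (transition (chart_at q) (chart_at p) (chart_map (chart_at q) q)).
  by rewrite tE.
have H := diff_comp dt dF'; rewrite -tE.
have nn : \forall z \near chart_map (chart_at q) q,
    (local_fun p F \o transition (chart_at q) (chart_at p)) z = local_fun q F z.
  apply: filterS (near_overlap dq cq) => z [dz cz zE].
  by rewrite /local_fun /= (atlas_mapK hM).
have H' := near_diff nn (differentiable_comp dt dF').
exact: (congr1 (fun F => F w) (etrans H' H)).
Qed.

End atlas.

Lemma manifold_atlas {R : realType} {E : normedModType R} (M : charted E) :
  is_manifold M -> differentiable_atlas M.
Proof.
move=> hM; split; [exact: chart_at_dom|exact: chart_mapK|exact: overlap_open|].
move=> c d p cp dp; have [dt _] := transition_smooth hM c d 1%N.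
by apply: dt; exists p.
Qed.

(** * Connections and the Koszul formula *)

Section fields.
Context {R : realType} {E : normedModType R} {M : charted E}.
Implicit Types (p q : M) (X Y : M -> E) (f : M -> R).

Lemma smooth_fieldD p X Y : smooth_field_at p X -> smooth_field_at p Y ->
  smooth_field_at p (fun q => X q + Y q).
Proof.
move=> sX sY; have := smooth_nearD sX sY; congr (smooth_near _ _).
by apply/funext => x; rewrite /local_field /components linearD.
Qed.

Lemma smooth_fieldZ p f X : smooth_fun_at p f -> smooth_field_at p X ->
  smooth_field_at p (fun q => f q *: X q).
Proof.
move=> sf sX; have := smooth_nearZ sf sX; congr (smooth_near _ _).
by apply/funext => x; rewrite /local_field /components /local_fun linearZ.
Qed.

Lemma smooth_field0 p : smooth_field_at p (fun=> 0).
Proof.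
have := @smooth_near_cst _ _ _ (0 : E) (chart_map (chart_at p) p).
by congr (smooth_near _ _); apply/funext => x;
  rewrite /local_field /components linear0.
Qed.

End fields.

Section connections.
Context {R : realType} {E : normedModType R} {M : charted E}.
Context (hM : differentiable_atlas M).
Variables (D : M -> E -> (M -> E) -> E) (hD : affine_connection D).
Implicit Types (p q : M) (X Y : M -> E) (f : M -> R).

Lemma conn0 p v : D p v (fun=> 0) = 0.
Proof.
have s0 : smooth_fun_at p (fun=> 0) by exact: smooth_near_cst.
have := conn_leibniz hD v s0 (smooth_field0 p).
have -> : (fun q : M => (0 : R) *: (0 : E)) = fun=> 0.
  by apply/funext => q; rewrite scaler0.
by move=> ->; rewrite scaler0 scale0r addr0.
Qed.

(** If a field [Z] vanishes near [p], then [Z = chi * Z] where [chi] is 0 at the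
    zeros of [Z] and 1 elsewhere.  As smoothness at [p] only constrains the germ
    at [p], [chi] is smooth there, and the Leibniz rule gives that the derivative
    of [Z] is zero. *)
Lemma conn_local p v X Y : smooth_field_at p X -> smooth_field_at p Y ->
  (\forall x \near chart_map (chart_at p) p,
     X (chart_inv (chart_at p) x) = Y (chart_inv (chart_at p) x)) ->
  D p v X = D p v Y.
Proof.
move=> sX sY XY; pose Z q := X q - Y q.
pose chi q : R := if Z q == 0 then 0 else 1.
have chiZ : (fun q => chi q *: Z q) = Z.
  apply/funext => q; rewrite /chi; case: eqP => [->|_]; first by rewrite scaler0.
  by rewrite scale1r.
have ZE x : X (chart_inv (chart_at p) x) = Y (chart_inv (chart_at p) x) ->
    Z (chart_inv (chart_at p) x) = 0.
  by rewrite /Z => ->; rewrite subrr.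
have Zp : Z p = 0.
  by have := ZE _ (nbhs_singleton XY); rewrite (chart_inv_at hM).
have schi : smooth_fun_at p chi.
  apply: (@eq_smooth_near _ _ _ (fun=> 0)); last exact: smooth_near_cst.
  by apply: filterS XY => x /ZE Zx; rewrite /local_fun /chi Zx eqxx.
have sZ : smooth_field_at p Z.
  apply: (@eq_smooth_near _ _ _ (fun=> 0)); last exact: smooth_near_cst.
  by apply: filterS XY => x /ZE Zx; rewrite /local_field Zx /components linear0.
have DZ : D p v Z = 0.
  rewrite -chiZ (conn_leibniz hD) // Zp scaler0 add0r.
  by rewrite /chi Zp eqxx scale0r.
have -> : X = (fun q => Y q + Z q) by apply/funext => q; rewrite /Z addrCA subrr addr0.
by rewrite (conn_add hD) // DZ addr0.
Qed.

Lemma conn_sum p v n (s : seq 'I_n) (f : 'I_n -> M -> R) (X : 'I_n -> M -> E) :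
  (forall i, smooth_fun_at p (f i)) -> (forall i, smooth_field_at p (X i)) ->
  smooth_field_at p (fun q => \sum_(i <- s) f i q *: X i q) /\
  D p v (fun q => \sum_(i <- s) f i q *: X i q) =
  \sum_(i <- s) (dirder p v (f i) *: X i p + f i p *: D p v (X i)).
Proof.
move=> sf sX; elim: s => [|i s [IHs IH]].
  rewrite big_nil.
  rewrite [X in D p v X](_ : _ = fun=> 0); last by apply/funext => q; rewrite big_nil.
  rewrite [X in smooth_field_at p X](_ : _ = fun=> 0); last by apply/funext => q; rewrite big_nil.
  by rewrite conn0; split => //; exact: smooth_field0.
have -> : (fun q => \sum_(j <- i :: s) f j q *: X j q) =
    (fun q => f i q *: X i q + \sum_(j <- s) f j q *: X j q).
  by apply/funext => q; rewrite big_cons.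
have sfX : smooth_field_at p (fun q => f i q *: X i q) by exact: smooth_fieldZ.
split; first exact: smooth_fieldD.
by rewrite (conn_add hD) // (conn_leibniz hD) // IH big_cons.
Qed.

Lemma conn_along0 p X : smooth_field_at p X -> D p 0 X = 0.
Proof.
move=> sX; have := conn_linear hD 1 0 0 sX.
rewrite !scale1r addr0 => H; apply: (@addrI _ (D p 0 X)).
by rewrite addr0 -H.
Qed.

Lemma torsion_free_const_ext p v w : torsion_free D ->
  D p v (const_ext p w) = D p w (const_ext p v).
Proof.
move=> tf; have := tf p _ _ (smooth_const_ext hM p v) (smooth_const_ext hM p w).
by rewrite !const_ext_self // lie_bracket_const_ext // => /eqP; rewrite subr_eq0 => /eqP.
Qed.

End connections.

Section koszul.
Context {R : realType} {E : normedModType R} {M : charted E}.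
Context (hM : differentiable_atlas M).
Variables (g : M -> E -> E -> R) (D : M -> E -> (M -> E) -> E).
Hypotheses (hg : riemannian_metric g) (hD : levi_civita g D).

Lemma metricDr p u v w : g p u (v + w) = g p u v + g p u w.
Proof.
rewrite (Defs.metric_sym hg) -[v]scale1r (metric_linear hg) mul1r scale1r.
by rewrite (Defs.metric_sym hg p v) (Defs.metric_sym hg p w).
Qed.

Lemma metricZr p a u v : g p u (a *: v) = a * g p u v.
Proof.
have g0 : g p 0 u = 0.
  have := metric_linear hg p 1 0 0 u; rewrite scale1r addr0 mul1r => H.
  by apply: (@addrI _ (g p 0 u)); rewrite addr0 -H.
rewrite (Defs.metric_sym hg) -[a *: v]addr0 (metric_linear hg) g0 addr0.
by rewrite (Defs.metric_sym hg p v).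
Qed.

Lemma metricDl p u v w : g p (v + w) u = g p v u + g p w u.
Proof. by rewrite (Defs.metric_sym hg) metricDr !(Defs.metric_sym hg p u). Qed.

Lemma metricZl p a u v : g p (a *: v) u = a * g p v u.
Proof. by rewrite (Defs.metric_sym hg) metricZr !(Defs.metric_sym hg p u). Qed.

Lemma metricBl p u v w : g p (v - w) u = g p v u - g p w u.
Proof. by rewrite metricDl -scaleN1r metricZl mulN1r. Qed.

Lemma metricBr p u v w : g p u (v - w) = g p u v - g p u w.
Proof. by rewrite !(Defs.metric_sym hg p u) metricBl. Qed.

Lemma metric0r p u : g p u 0 = 0.
Proof. by rewrite -(scale0r 0) metricZr mul0r. Qed.

Definition metric_deriv p u v w : R :=
  dirder p u (fun q => g q (const_ext p v q) (const_ext p w q)).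

Lemma metric_deriv_conn p u v w :
  metric_deriv p u v w =
  g p (D p u (const_ext p v)) w + g p v (D p u (const_ext p w)).
Proof.
case: hD => _ _ /(_ p _ _ _ (smooth_const_ext hM p u) (smooth_const_ext hM p v)
  (smooth_const_ext hM p w)).
rewrite /nabla_metric !const_ext_self // => /eqP.
by rewrite -addrA -opprD subr_eq0 => /eqP.
Qed.

(** Coordinate fields commute, so the Koszul formula has no bracket terms. *)
Lemma koszul p u v w :
  2 * g p (D p u (const_ext p v)) w =
  metric_deriv p u v w + metric_deriv p v u w - metric_deriv p w u v.
Proof.
rewrite !metric_deriv_conn.
case: hD => _ tf _.
rewrite (torsion_free_const_ext hM p v u tf) (torsion_free_const_ext hM p w u tf).
rewrite (torsion_free_const_ext hM p w v tf) !(Defs.metric_sym hg p _ w).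
rewrite (Defs.metric_sym hg p v (D p u _)).
by ring.
Qed.

End koszul.

Section coordinates.
Context {R : realType} {E : normedModType R} {n : nat} (b : finite_basis E n).
Context {M : charted E}.
Context (hM : differentiable_atlas M).
Variables (D : M -> E -> (M -> E) -> E).
Hypothesis (hD : affine_connection D).
Implicit Types (p q : M) (X Y : M -> E).

Lemma const_extE p v q :
  const_ext p v q = \sum_i basis_coord b i v *: const_ext p (basis_vec b i) q.
Proof. exact: (linear_basis_expand b v (linearP _)). Qed.

Lemma conn_const_extE p u v : D p u (const_ext p v) =
  \sum_i basis_coord b i v *: D p u (const_ext p (basis_vec b i)).
Proof.
have scst i : smooth_fun_at p (fun=> basis_coord b i v) by exact: smooth_near_cst.
have [_] := @conn_sum _ _ _ _ hD p u n (index_enum 'I_n) (fun i _ => basis_coord b i v)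
  _ scst (fun i => smooth_const_ext hM p (basis_vec b i)).
have -> : (fun q => \sum_i basis_coord b i v *: const_ext p (basis_vec b i) q) = const_ext p v.
  by apply/funext => q; rewrite [RHS]const_extE.
move=> ->; apply: eq_bigr => i _; rewrite /dirder /local_fun.
by rewrite diff_cst scale0r add0r.
Qed.

(** The classical formula [dX(v) + Gamma(v, X)]: expand [X] in the coordinate
    fields of the chart at [p] and apply the Leibniz rule. *)
Lemma conn_coord p v X : smooth_field_at p X ->
  D p v X = 'd (local_field p X) (chart_map (chart_at p) p) v
            + D p v (const_ext p (X p)).
Proof.
move=> sX; set c := chart_at p; set x0 := chart_map c p.
pose l i (q : M) : R := basis_coord b i (components c q (X q)).
have dX : is_diff x0 (local_field p X) ('d (local_field p X) x0).
  exact/differentiableP/smooth_near_differentiable.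
have sl i : smooth_fun_at p (l i).
  exact: (smooth_near_linear_comp (basis_coord_linear b i) (@basis_coord_continuous _ _ _ b i) sX).
have [sS DS] := @conn_sum _ _ _ _ hD p v n (index_enum 'I_n) l
  _ sl (fun i => smooth_const_ext hM p (basis_vec b i)).
have -> : D p v X = D p v (fun q => \sum_i l i q *: const_ext p (basis_vec b i) q).
  apply: (conn_local hM hD) => //.
  have := near_chart_at hM p; apply: filterS => x [cx _].
  by rewrite -const_extE const_ext_components.
rewrite DS big_split /= conn_const_extE; congr (_ + _).
  rewrite [RHS](basis_expand b); apply: eq_bigr => i _.
  rewrite const_ext_self //; congr (_ *: _).
  rewrite /dirder.
  have [_ dE] := is_diff_comp dX (is_diff_linear (local_field p X x0)
    (basis_coord_linear b i) (@basis_coord_continuous _ _ _ b i)).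
  exact: (congr1 (fun F => F v) dE).
by apply: eq_bigr => i _; rewrite /l components_chart_at.
Qed.

End coordinates.

(** * Christoffel symbols and metric coefficients *)

Section chart_expressions.
Context {R : realType} {E : normedModType R} {n : nat} (bE : finite_basis E n).
Context {M : charted E} (hM : is_manifold M).
Let aM := manifold_atlas hM.
Local Notation transition c d := (chart_map d \o chart_inv c).
Local Notation base p := (chart_map (chart_at p) p).
Implicit Types (p q : M) (D : M -> E -> (M -> E) -> E).

Lemma smooth_transition (c d : chart M) p : chart_dom c p -> chart_dom d p ->
  smooth_near (transition c d) (chart_map c p).
Proof.
move=> cp dp; exists (chart_map c @` (chart_dom c `&` chart_dom d)); split.
- exact: (overlap_open hM).
- by exists p.
- exact: (transition_smooth hM).
Qed.

(** In the chart at [q], the components of [const_ext p v] are a derivative of one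
    transition map composed with the inverse one. *)
Lemma smooth_const_ext_near p q v : chart_dom (chart_at p) q ->
  smooth_field_at q (const_ext p v).
Proof.
move=> cq; have dq := atlas_chart_at aM q.
have st := smooth_transition dq cq; have st' := smooth_transition cq dq.
have tE : transition (chart_at q) (chart_at p) (base q) = chart_map (chart_at p) q.
  by rewrite /= (atlas_mapK aM).
apply: (@eq_smooth_near _ _ _ (fun z => 'D_v (transition (chart_at p) (chart_at q))
   (transition (chart_at q) (chart_at p) z))).
  apply: filterS2 (local_field_const_ext_chart aM v cq) (near_overlap aM dq cq).
  move=> z -> [dz cz _]; rewrite deriveE //.
  have -> : transition (chart_at q) (chart_at p) z =
    chart_map (chart_at p) (chart_inv (chart_at q) z) by [].
  exact: (atlas_transition aM).
apply: (smooth_near_comp bE (f := 'D_v (transition (chart_at p) (chart_at q)))) => //.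
by rewrite tE; exact: smooth_near_derive.
Qed.

(** The Christoffel symbols of [D] in the chart at [p], as a map of the point [x]
    for fixed arguments [a] and [b]: [Gamma^k_ij a^i b^j]. *)
Definition christoffel D p (a b : E) : E -> E :=
  local_field p (fun q => D q (const_ext p a q) (const_ext p b)).

Lemma smooth_christoffel D p a b : affine_connection D ->
  smooth_near (christoffel D p a b) (base p).
Proof. by move=> hD; apply: (conn_smooth hD); exact: (smooth_const_ext aM). Qed.

Lemma christoffel_base D p a b : christoffel D p a b (base p) = D p a (const_ext p b).
Proof. by rewrite /christoffel local_field_at // const_ext_self. Qed.

Lemma christoffelE D p q a b : chart_dom (chart_at p) q ->
  D q (const_ext p a q) (const_ext p b) =
  const_ext p (christoffel D p a b (chart_map (chart_at p) q)) q.
Proof.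
move=> cq; rewrite /christoffel /local_field (atlas_mapK aM) //.
by rewrite const_ext_components.
Qed.

Lemma const_extP p q s v w : const_ext p (s *: v + w) q =
  s *: const_ext p v q + const_ext p w q.
Proof. by rewrite /const_ext linearP. Qed.

Lemma conn_const_extP D p q u s v w : affine_connection D ->
  chart_dom (chart_at p) q ->
  D q u (const_ext p (s *: v + w)) =
  s *: D q u (const_ext p v) + D q u (const_ext p w).
Proof.
move=> hD cq.
have -> : const_ext p (s *: v + w) =
    (fun q => s *: const_ext p v q + const_ext p w q).
  by apply/funext => q'; rewrite const_extP.
have sv := smooth_const_ext_near v cq; have sw := smooth_const_ext_near w cq.
have ss : smooth_fun_at q (fun=> s) by exact: smooth_near_cst.
rewrite (conn_add hD) //; last exact: smooth_fieldZ.
rewrite (conn_leibniz hD) //.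
by rewrite /dirder /local_fun diff_cst scale0r add0r.
Qed.

Lemma christoffel_linearl D p b x : affine_connection D ->
  chart_dom (chart_at p) (chart_inv (chart_at p) x) ->
  linear (fun a => christoffel D p a b x).
Proof.
move=> hD cx s v w; rewrite /christoffel /local_field const_extP.
rewrite (conn_linear hD); last exact: smooth_const_ext_near.
by rewrite /components linearP.
Qed.

Lemma christoffel_linearr D p a x : affine_connection D ->
  chart_dom (chart_at p) (chart_inv (chart_at p) x) ->
  linear (fun b => christoffel D p a b x).
Proof.
move=> hD cx s v w; rewrite /christoffel /local_field conn_const_extP //.
by rewrite /components linearP.
Qed.

Lemma near_base_dom p : \forall x \near base p,
  chart_dom (chart_at p) (chart_inv (chart_at p) x).
Proof. by apply: filterS (near_chart_at aM p) => x []. Qed.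

(** By [conn_coord], both connections differentiate the components of a field in
    the same way, so that the components of [D - Dg] are the differences of the
    Christoffel symbols, at every point of the chart. *)
Lemma diff_tensorE D Dg p q a b : affine_connection D -> affine_connection Dg ->
  chart_dom (chart_at p) q ->
  diff_tensor D Dg q (const_ext p a q) (const_ext p b q) =
  const_ext p (christoffel D p a b (chart_map (chart_at p) q)
               - christoffel Dg p a b (chart_map (chart_at p) q)) q.
Proof.
move=> hD hDg cq.
have -> : forall v w, const_ext p (v - w) q = const_ext p v q - const_ext p w q.
  by move=> v w; rewrite /const_ext linearB.
rewrite -!christoffelE // /diff_tensor.
have sb := smooth_const_ext_near b cq.
rewrite [in RHS](conn_coord bE aM hD) // [X in _ = _ - X](conn_coord bE aM hDg) //.
by rewrite opprD addrACA subrr add0r.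
Qed.

Lemma local_diff_tensor D Dg p a b : affine_connection D -> affine_connection Dg ->
  \forall x \near base p,
  local_field p (fun q => diff_tensor D Dg q (const_ext p a q) (const_ext p b q)) x =
  christoffel D p a b x - christoffel Dg p a b x.
Proof.
move=> hD hDg; apply: filterS (near_chart_at aM p) => x [cx xE].
by rewrite {1}/local_field diff_tensorE // xE components_const_ext.
Qed.

Lemma curvatureE D p u v w : affine_connection D -> 
  curvature D p u v w =
  ('d (christoffel D p v w) (base p) u + D p u (const_ext p (D p v (const_ext p w))))
  - ('d (christoffel D p u w) (base p) v + D p v (const_ext p (D p u (const_ext p w)))).
Proof.
move=> hD; rewrite /curvature lie_bracket_const_ext //.
rewrite (conn_along0 hD); last exact: smooth_const_ext.
have H a b : D p a (fun q => D q (const_ext p b q) (const_ext p w)) =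
    'd (christoffel D p b w) (base p) a + D p a (const_ext p (D p b (const_ext p w))).
  rewrite (conn_coord bE aM hD); last exact: smooth_christoffel.
  by rewrite const_ext_self.
by rewrite !H subr0.
Qed.

Lemma smooth_diff_tensor D Dg p a b : affine_connection D -> affine_connection Dg ->
  smooth_near (fun x => christoffel D p a b x - christoffel Dg p a b x) (base p).
Proof.
move=> hD hDg.
have -> : (fun x => christoffel D p a b x - christoffel Dg p a b x) =
    (fun x => christoffel D p a b x + (cst (-1) x : R^o) *: christoffel Dg p a b x).
  by apply/funext => x; rewrite scaleN1r.
apply: smooth_nearD; first exact: smooth_christoffel.
apply: smooth_nearZ; [exact: smooth_near_cst|exact: smooth_christoffel].
Qed.

Lemma cov_tensorE D Dg p u v w : affine_connection D -> affine_connection Dg ->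
  let K := diff_tensor D Dg in
  cov_tensor Dg K p u v w =
  'd (christoffel D p v w) (base p) u - 'd (christoffel Dg p v w) (base p) u
  + Dg p u (const_ext p (K p v w))
  - K p (Dg p u (const_ext p v)) w - K p v (Dg p u (const_ext p w)).
Proof.
move=> hD hDg K; rewrite /cov_tensor.
have nK := local_diff_tensor p v w hD hDg.
have sK : smooth_field_at p (fun q => K q (const_ext p v q) (const_ext p w q)).
  apply: (@eq_smooth_near _ _ _ (fun x => christoffel D p v w x - christoffel Dg p v w x)).
    by apply: filterS nK => x ->.
  exact: smooth_diff_tensor.
pose dK (x : E) := christoffel D p v w x - christoffel Dg p v w x.
have [dB dBE] : is_diff (base p) dK
    (fun u => 'd (christoffel D p v w) (base p) u - 'd (christoffel Dg p v w) (base p) u).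
  exact: (is_diffB
    (differentiableP (smooth_near_differentiable (smooth_christoffel p v w hD)))
    (differentiableP (smooth_near_differentiable (smooth_christoffel p v w hDg)))).
have dKE : 'd (local_field p (fun q => K q (const_ext p v q) (const_ext p w q))) (base p)
    = 'd dK (base p) :> (E -> E).
  by apply: near_diff => //; apply: filterS nK => x ->.
by rewrite (conn_coord bE aM hDg u sK) !(const_ext_self aM) dKE dBE.
Qed.

End chart_expressions.

Section metric_in_chart.
Context {R : realType} {E : normedModType R} {n : nat} (bE : finite_basis E n).
Context {M : charted E} (hM : is_manifold M).
Let aM := manifold_atlas hM.
Local Notation base p := (chart_map (chart_at p) p).
Implicit Types (p q : M).
Variables (g : M -> E -> E -> R) (D Dg : M -> E -> (M -> E) -> E).
Hypotheses (hg : riemannian_metric g) (hDg : levi_civita g Dg).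

(** The metric coefficients [g_ij a^i b^j] in the chart at [p]. *)
Definition metric_coef p (a b : E) : E -> R^o :=
  local_fun p (fun q => g q (const_ext p a q) (const_ext p b q)).

Lemma smooth_metric_coef p a b : smooth_near (metric_coef p a b) (base p).
Proof. by apply: (metric_smooth hg); exact: (smooth_const_ext aM). Qed.

Lemma metric_coefE p q a b : chart_dom (chart_at p) q ->
  metric_coef p a b (chart_map (chart_at p) q) =
  g q (const_ext p a q) (const_ext p b q).
Proof. by move=> cq; rewrite /metric_coef /local_fun (atlas_mapK aM). Qed.

Lemma metric_coef_base p a b : metric_coef p a b (base p) = g p a b.
Proof.
rewrite metric_coefE ?(const_ext_self aM) //.
exact: (atlas_chart_at aM).
Qed.

Lemma metric_coef_linearl p b x : linear (fun a => metric_coef p a b x).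
Proof.
move=> s v w; rewrite /metric_coef /local_fun const_extP.
by rewrite (metric_linear hg).
Qed.

Lemma metric_coefC p a b x : metric_coef p a b x = metric_coef p b a x.
Proof. by rewrite /metric_coef /local_fun (Defs.metric_sym hg). Qed.

Lemma metric_coef_linearr p a x : linear (fun b => metric_coef p a b x).
Proof.
move=> s v w; rewrite metric_coefC metric_coef_linearl.
by rewrite !(metric_coefC p a).
Qed.

(** Compatibility of [Dg] with the metric at [q], read in the chart at [p]. *)
Lemma diff_metric_coef p q a b u : chart_dom (chart_at p) q ->
  let x := chart_map (chart_at p) q in
  differentiable (metric_coef p a b) x ->
  'd (metric_coef p a b) x u =
  metric_coef p (christoffel Dg p u a x) b x
  + metric_coef p a (christoffel Dg p u b x) x.
Proof.
move=> cq x dx.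
have [aDg tf lc] := hDg.
have sx w := smooth_const_ext_near bE hM w cq.
have := lc q _ _ _ (sx u) (sx a) (sx b).
rewrite /nabla_metric (dirder_chart aM _ cq) // components_const_ext // => /eqP.
rewrite -addrA -opprD subr_eq0 => /eqP.
rewrite !(christoffelE hM _ _ _ cq).
by rewrite /x !(metric_coefE _ _ cq).
Qed.

Lemma metric_coef_expand p a b x : metric_coef p a b x =
  \sum_i basis_coord bE i a *: \sum_j basis_coord bE j b *:
    metric_coef p (basis_vec bE i) (basis_vec bE j) x.
Proof.
rewrite (linear_basis_expand bE a (metric_coef_linearl p b x)).
apply: eq_bigr => i _; congr (_ *: _).
exact: (linear_basis_expand bE b (metric_coef_linearr p _ x)).
Qed.

(** One neighbourhood serves for all [a] and [b], since differentiability for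
    finitely many basis vectors implies it for all. *)
Lemma near_differentiable_metric_coef p :
  \forall x \near base p, forall a b, differentiable (metric_coef p a b) x.
Proof.
have : \forall x \near base p, forall i j,
    differentiable (metric_coef p (basis_vec bE i) (basis_vec bE j)) x.
  apply: filter_forall => i; apply: filter_forall => j.
  have := smooth_near_is_near (smooth_metric_coef p (basis_vec bE i) (basis_vec bE j)).
  by apply: filterS => x; exact: smooth_near_differentiable.
apply: filterS => x dx a b.
rewrite (_ : metric_coef p a b = \sum_i (basis_coord bE i a *:
    \sum_j (basis_coord bE j b *: metric_coef p (basis_vec bE i) (basis_vec bE j)))).
  apply: differentiable_sum => i; apply: differentiableZ.
  by apply: differentiable_sum => j; apply: differentiableZ.
apply/funext => y; rewrite metric_coef_expand fct_sumE; apply: eq_bigr => i _.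
by rewrite [RHS]/GRing.scale /= fct_sumE.
Qed.

Lemma is_diff_metric_coef (V : normedModType R) p (s ds u du w dw : V -> E) z :
  (forall a b, differentiable (metric_coef p a b) (s z)) ->
  is_diff z s ds -> is_diff z u du -> is_diff z w dw ->
  is_diff z (fun y => metric_coef p (u y) (w y) (s y))
    (fun v => 'd (metric_coef p (u z) (w z)) (s z) (ds v)
       + metric_coef p (u z) (dw v) (s z)
       + metric_coef p (du v) (w z) (s z)).
Proof.
move=> dsz hs hu hw.
have dm a b : is_diff z (fun y => metric_coef p a b (s y))
    (fun v => 'd (metric_coef p a b) (s z) (ds v)).
  exact: (is_diff_comp hs (differentiableP (dsz a b))).
have dm2 a : is_diff z (fun y => metric_coef p a (w y) (s y))
    (fun v => 'd (metric_coef p a (w z)) (s z) (ds v)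
       + metric_coef p a (dw v) (s z)).
  have H := @is_diff_linear_family _ V E R^o n bE
    (fun b y => metric_coef p a b (s y)) w dw z.
  apply: (is_diff_eq (H _ _ hw)).
  - apply: nearW => y b.
    exact: (linear_basis_expand bE b (metric_coef_linearr p a (s y))).
  - by move=> i; have [] := dm a (basis_vec bE i).
  - by apply/funext => v; have [_ ->] := dm a (w z).
have H := @is_diff_linear_family _ V E R^o n bE
    (fun a y => metric_coef p a (w y) (s y)) u du z.
apply: (is_diff_eq (H _ _ hu)).
- apply: nearW => y a.
  exact: (linear_basis_expand bE a (metric_coef_linearl p (w y) (s y))).
- by move=> i; have [] := dm2 (basis_vec bE i).
- by apply/funext => v; have [_ ->] := dm2 (u z).
Qed.

Lemma differentiable_metric_coef p a b : differentiable (metric_coef p a b) (base p).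
Proof. exact/smooth_near_differentiable/smooth_metric_coef. Qed.

Lemma is_diff_christoffel (V : normedModType R) p a (s ds w dw : V -> E) z :
  affine_connection D ->
  s z = base p -> is_diff z s ds -> is_diff z w dw ->
  is_diff z (fun y => christoffel D p a (w y) (s y))
    (fun v => 'd (christoffel D p a (w z)) (base p) (ds v)
       + christoffel D p a (dw v) (base p)).
Proof.
move=> hD sz hs hw.
have dm b : is_diff z (fun y => christoffel D p a b (s y))
    (fun v => 'd (christoffel D p a b) (base p) (ds v)).
  have H : is_diff (s z) (christoffel D p a b) ('d (christoffel D p a b) (base p)).
    rewrite sz; apply: differentiableP.
    exact/smooth_near_differentiable/smooth_christoffel.
  exact: (is_diff_comp hs H).
have H := @is_diff_linear_family _ V E E n bE
    (fun b y => christoffel D p a b (s y)) w dw z.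
apply: (is_diff_eq (H _ _ hw)).
- have : \forall y \near z, chart_dom (chart_at p) (chart_inv (chart_at p) (s y)).
    have [ds' _] := hs; have nb := near_base_dom hM p; rewrite -sz in nb.
    exact: (differentiable_continuous ds' nb).
  apply: filterS => y cy b.
  exact: (linear_basis_expand bE b (christoffel_linearr bE hM a hD cy)).
- by move=> i; have [] := dm (basis_vec bE i).
- by apply/funext => v; have [_ ->] := dm (w z); rewrite sz.
Qed.

End metric_in_chart.

(** * Symmetries of the difference tensor *)

Section difference_tensor.
Context {R : realType} {E : normedModType R} {n : nat} (bE : finite_basis E n).
Context {M : charted E} (hM : is_manifold M).
Let aM := manifold_atlas hM.
Local Notation base p := (chart_map (chart_at p) p).
Implicit Types (p q : M).
Variables (g : M -> E -> E -> R) (D Dg : M -> E -> (M -> E) -> E).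
Hypotheses (hg : statistical_structure g D) (hDg : levi_civita g Dg).
Let K := diff_tensor D Dg.

Lemma diff_tensorC q a b : K q a b = K q b a.
Proof.
have [_ _ tf _] := hg; have [_ tfg _] := hDg.
by rewrite /K /diff_tensor (torsion_free_const_ext aM q a b tf)
  (torsion_free_const_ext aM q a b tfg).
Qed.

(** As [Dg] is metric, [(D_u g)(v, w) = - g(K(u, v), w) - g(v, K(u, w))].  The
    Codazzi equation and the symmetry of [K] then make [g(K(u, v), w)] totally
    symmetric. *)
Lemma metric_diff_tensor q a b c : g q (K q a b) c = g q (K q a c) b.
Proof.
have [rg _ tf cod] := hg.
have nm u v w : nabla_metric D g (const_ext q u) (const_ext q v) (const_ext q w) q
    = - g q (K q u v) w - g q v (K q u w).
  rewrite /nabla_metric !(const_ext_self aM).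
  rewrite -/(metric_deriv g q u v w) (metric_deriv_conn aM hDg).
  rewrite /K /diff_tensor (metricBl rg) (metricBr rg).
  by ring.
have H2 u v w : g q (K q u v) w = g q (K q w v) u.
  have := cod q _ _ _ (smooth_const_ext aM q u) (smooth_const_ext aM q w)
    (smooth_const_ext aM q v).
  rewrite !nm (diff_tensorC q w u) !(Defs.metric_sym rg q _ (K _ _ _)) => H'.
  by lra.
by rewrite (diff_tensorC q a b) H2 (diff_tensorC q c a).
Qed.

Definition diff_christoffel p a b x : E :=
  christoffel D p a b x - christoffel Dg p a b x.

Lemma diff_christoffel_const_ext p q a b : chart_dom (chart_at p) q ->
  const_ext p (diff_christoffel p a b (chart_map (chart_at p) q)) q =
  K q (const_ext p a q) (const_ext p b q).
Proof.
have [_ aD _ _] := hg; have [aDg _ _] := hDg.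
by move=> cq; rewrite /K (diff_tensorE bE hM a b aD aDg cq).
Qed.

Lemma diff_christoffel_base p a b : diff_christoffel p a b (base p) = K p a b.
Proof.
rewrite -[LHS](const_ext_self aM p) diff_christoffel_const_ext.
  by rewrite !(const_ext_self aM).
exact: (atlas_chart_at aM).
Qed.

Lemma diff_christoffelC p a b :
  \forall x \near base p, diff_christoffel p a b x = diff_christoffel p b a x.
Proof.
apply: filterS (near_chart_at aM p) => x [cx xE].
rewrite -xE -[LHS](components_const_ext aM _ cx) -[RHS](components_const_ext aM _ cx).
by rewrite !diff_christoffel_const_ext // diff_tensorC.
Qed.

Lemma metric_diff_christoffel p a b c :
  \forall x \near base p, metric_coef g p (diff_christoffel p a b x) c x =
    metric_coef g p (diff_christoffel p a c x) b x.
Proof.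
apply: filterS (near_chart_at aM p) => x [cx xE].
rewrite -xE !(metric_coefE hM _ _ _ cx) !diff_christoffel_const_ext //.
exact: metric_diff_tensor.
Qed.

(** The derivative along [u] of the components of [K] in the chart, which differs
    from the covariant derivative of [K] by terms in the Christoffel symbols. *)
Definition ddiff_christoffel p u a b : E :=
  'd (christoffel D p a b) (base p) u - 'd (christoffel Dg p a b) (base p) u.

Lemma is_diff_diff_christoffel p a b :
  is_diff (base p) (diff_christoffel p a b) (ddiff_christoffel p ^~ a ^~ b).
Proof.
have [_ aD _ _] := hg; have [aDg _ _] := hDg.
exact: (is_diffB
    (differentiableP (smooth_near_differentiable (smooth_christoffel hM p a b aD)))
    (differentiableP (smooth_near_differentiable (smooth_christoffel hM p a b aDg)))).
Qed.

Lemma ddiff_christoffelC p u a b :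
  ddiff_christoffel p u a b = ddiff_christoffel p u b a.
Proof.
have H := near_is_diff_unique (diff_christoffelC p a b)
  (is_diff_diff_christoffel p a b) (is_diff_diff_christoffel p b a).
exact: (congr1 (fun F => F u) H).
Qed.

(** Total symmetry of [K] holds at all points near [p] and can be differentiated. *)
Lemma metric_ddiff_christoffel p u a b c :
  'd (metric_coef g p (K p a b) c) (base p) u + g p (ddiff_christoffel p u a b) c =
  'd (metric_coef g p (K p a c) b) (base p) u + g p (ddiff_christoffel p u a c) b.
Proof.
have [rg _ _ _] := hg.
have H v w : is_diff (base p) (fun x => metric_coef g p (diff_christoffel p a v x) w x)
    (fun u => 'd (metric_coef g p (K p a v) w) (base p) u
              + g p (ddiff_christoffel p u a v) w).
  apply: (is_diff_eq (is_diff_metric_coef bE rg (differentiable_metric_coef hM rg p)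
    (is_diff_id (base p)) (is_diff_diff_christoffel p a v) (is_diff_cst w _))).
  apply/funext => t; rewrite diff_christoffel_base !(metric_coef_base hM) //=.
  by rewrite (metric0r rg) addr0.
have H' := near_is_diff_unique (metric_diff_christoffel p a b c) (H b c) (H c b).
exact: (congr1 (fun F => F u) H').
Qed.

End difference_tensor.

(** * The tangent bundle and the Sasakian metric *)

Section tangent_bundle_atlas.
Context {R : realType} {E : normedModType R} {n : nat} (bE : finite_basis E n).
Context {M : charted E} (hM : is_manifold M).
Let aM := manifold_atlas hM.
Local Notation base p := (chart_map (chart_at p) p).
Local Notation transition c d := (chart_map d \o chart_inv c).
Local Notation TM := (tangent_bundle M).
Local Notation tmap c := (@chart_map R (E * E)%type TM c).
Local Notation tinv c := (@chart_inv R (E * E)%type TM c).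
Implicit Types (p q : M) (zeta : TM) (c d : chart M).

Lemma components_diff_inv c d q v : chart_dom c q -> chart_dom d q ->
  components d q ('d (transition c (chart_at q)) (chart_map c q) v) =
  'd (transition c d) (chart_map c q) v.
Proof.
move=> cq dq; rewrite /components transition_cocycle //.
exact: (atlas_chart_at aM).
Qed.

Lemma diff_transitionE c d q v : chart_dom c q -> chart_dom d q ->
  'd (transition c d) (chart_map c q) v = 'D_v (transition c d) (chart_map c q).
Proof. by move=> cq dq; rewrite deriveE //; exact: (atlas_transition aM). Qed.

Lemma near_tangent_transition c d zeta : chart_dom c zeta.1 -> chart_dom d zeta.1 ->
  \forall z \near tmap c zeta, (tmap d \o tinv c) z =
    (transition c d z.1, 'D_(z.2) (transition c d) z.1).
Proof.
move=> cz dz.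
have nc : \forall x \near (tmap c zeta).1,
    [/\ chart_dom c (chart_inv c x), chart_dom d (chart_inv c x) &
        chart_map c (chart_inv c x) = x] by exact: (near_overlap aM cz dz).
apply: filterS (near_fst nc) => -[x y] /= [cx dx xE].
congr (_, _); rewrite -[in LHS]xE (atlas_mapK aM) // components_diff_inv //.
by rewrite diff_transitionE // xE.
Qed.

(** The transition maps of [TM] are [(x, y) |-> (t x, dt_x y)] for the transition
    maps [t] of [M]; the second component is linear in [y]. *)
Lemma is_diff_tangent_transition c d zeta :
  chart_dom c zeta.1 -> chart_dom d zeta.1 ->
  let z := tmap c zeta in
  is_diff z (tmap d \o tinv c)
    (fun w => ('d (transition c d) (z.1) w.1,
               'd ('D_(z.2) (transition c d)) (z.1) w.1 + 'd (transition c d) (z.1) w.2)).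
Proof.
move=> cz dz z; set t := transition c d.
have st : smooth_near t z.1 by exact: (smooth_transition hM).
have dt : is_diff (z.1) t ('d t (z.1)).
  exact/differentiableP/smooth_near_differentiable.
have h1 := is_diff_comp (is_diff_fst z) dt.
have dDt y : is_diff z (fun z => 'D_y t z.1) (fun w => 'd ('D_y t) (z.1) w.1).
  have H : is_diff (z.1) ('D_y t) ('d ('D_y t) (z.1)).
    exact/differentiableP/smooth_near_differentiable/smooth_near_derive.
  exact: (is_diff_comp (is_diff_fst z) H).
have h2 : is_diff z (fun z => 'D_(z.2) t z.1)
    (fun w => 'd ('D_(z.2) t) (z.1) w.1 + 'd t (z.1) w.2).
  have H := @is_diff_linear_family _ _ E E n bE
    (fun y z => 'D_y t z.1) snd snd z.
  apply: (is_diff_eq (H _ _ (is_diff_snd z))).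
  - apply: (@near_fst _ _ _ _ (fun x => forall a, 'D_a t x =
        \sum_i basis_coord bE i a *: 'D_(basis_vec bE i) t x)).
    apply: filterS (near_overlap aM cz dz) => x [cx dx xE] a.
    rewrite -xE -diff_transitionE //.
    rewrite (linear_basis_expand bE a (linearP _)); apply: eq_bigr => i _.
    by rewrite diff_transitionE.
  - by move=> i; have [] := dDt (basis_vec bE i).
  - apply/funext => w; have [_ ->] := dDt z.2.
    by rewrite -diff_transitionE.
have h := @is_diff_pair _ _ _ _ _ _ _ _ _ h1 h2.
apply: near_is_diff h.
by apply: filterS (near_tangent_transition cz dz) => y ->.
Qed.

Lemma tangent_atlas : differentiable_atlas TM.
Proof.
split.
- by move=> zeta; exact: (atlas_chart_at aM).
- move=> c [q v] /= cq; rewrite (atlas_mapK aM) //; congr (_, _).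
  rewrite /components transition_cocycle //; try exact: (atlas_chart_at aM).
  exact/(transition_id aM)/(atlas_chart_at aM).
- move=> /= c' d'; pose c : chart M := c'; pose d : chart M := d'.
  rewrite -/c -/d; suff -> : tmap c @` (@chart_dom R _ TM c `&` @chart_dom R _ TM d) =
      (fst : (E * E)%type -> E) @^-1` (chart_map c @` (chart_dom c `&` chart_dom d)).
    apply: open_comp; last exact: (atlas_overlap aM).
    by move=> z _; exact: fst_continuous.
  apply/seteqP; split => [_ [[q v] [/= cq dq] <-]|[x y] [q [cq dq] /= qE]].
    by exists q.
  exists (q, 'd (transition c (chart_at q)) (chart_map c q) y); first by split.
  by rewrite /= components_diff_inv // transition_id // qE.
- move=> c d zeta cz dz; have [] := is_diff_tangent_transition cz dz.
  by [].
Qed.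

Lemma tangent_const_extE (eta zeta : TM) A : chart_dom (chart_at eta.1) zeta.1 ->
  let z := tmap (chart_at eta.1) zeta in
  const_ext eta A zeta = (const_ext eta.1 A.1 zeta.1,
    'd ('D_(z.2) (transition (chart_at eta.1) (chart_at zeta.1))) (z.1) A.1
    + const_ext eta.1 A.2 zeta.1).
Proof.
move=> cz z.
have [_ dE] := is_diff_tangent_transition cz (atlas_chart_at aM zeta.1).
by rewrite /const_ext dE.
Qed.

(** The second derivative of a transition map, seen from either of its two charts. *)
Lemma diff_local_const_ext p q a y : chart_dom (chart_at p) q ->
  'd (local_field q (const_ext p y)) (base q) (const_ext p a q) =
  'd ('D_y (transition (chart_at p) (chart_at q))) (chart_map (chart_at p) q) a.
Proof.
move=> cq; have dq := atlas_chart_at aM q.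
set t := transition (chart_at p) (chart_at q).
set s := transition (chart_at q) (chart_at p).
have sE : s (base q) = chart_map (chart_at p) q by rewrite /s /= (atlas_mapK aM).
have dD : is_diff (s (base q)) ('D_y t) ('d ('D_y t) (chart_map (chart_at p) q)).
  rewrite sE; apply/differentiableP/smooth_near_differentiable/smooth_near_derive.
  exact: (smooth_transition hM).
have ds := differentiableP (atlas_transition aM dq cq).
have [dc dcE] := is_diff_comp ds dD.
have -> : 'd (local_field q (const_ext p y)) (base q) = 'd ('D_y t \o s) (base q) :> (E -> E).
  apply: near_diff => //.
  apply: filterS2 (local_field_const_ext_chart aM y cq) (near_overlap aM dq cq).
  move=> z -> [dz cz zE] /=; rewrite -/t.
  by rewrite diff_transitionE.
rewrite dcE /=; congr ('d _ _ _).
exact: (components_const_ext aM).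
Qed.

(** A change of chart on [TM] involves the second derivative of the transition
    map, and so does the change of the Christoffel symbols.  The two cancel: the
    vertical part of a coordinate field of [TM] has components [b + Gamma(a, y)]
    in the chart at [p]. *)
Lemma tangent_const_ext_vertical D (eta zeta : TM) A : affine_connection D ->
  let p := eta.1 in let z := tmap (chart_at p) zeta in
  chart_dom (chart_at p) zeta.1 ->
  (const_ext eta A zeta).2
  + D zeta.1 (const_ext eta A zeta).1 (const_ext zeta.1 zeta.2) =
  const_ext p (A.2 + christoffel D p A.1 z.2 z.1) zeta.1.
Proof.
move=> hD p z cz; rewrite tangent_const_extE //=.
rewrite -diff_local_const_ext // -/p.
set y := components _ _ _.
have -> : zeta.2 = const_ext p y zeta.1 by rewrite const_ext_components.
rewrite addrAC.
have sy := smooth_const_ext_near bE hM y cz.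
rewrite -(conn_coord bE aM hD _ sy) christoffelE // addrC.
by rewrite /const_ext linearD.
Qed.

End tangent_bundle_atlas.

Section lifts.
Context {R : realType} {E : normedModType R}.
Context {M : charted E} (aM : differentiable_atlas M).
Local Notation base p := (chart_map (chart_at p) p).
Local Notation TM := (tangent_bundle M).
Implicit Types (p q : M) (zeta eta : TM).
Variables (D : M -> E -> (M -> E) -> E).

Lemma vertical_liftE eta X : vertical_lift eta X = (0, X).
Proof.
rewrite /vertical_lift /velocity.
have -> : local_curve (fun t => (eta.1, eta.2 + t *: X) : TM) 0 =
    (fun s : R^o => (base eta.1, eta.2 + s *: X)).
  by apply/funext => s; rewrite /local_curve /= components_chart_at.
have [d dE] := is_diff_pair (is_diff_cst (base eta.1) (0 : R^o)) (is_diff_line eta.2 X 0).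
by rewrite deriveE // dE scale1r.
Qed.

(** The equation of parallel transport at time 0, in the chart at the point. *)
Lemma horizontal_liftE eta X A : is_horizontal_lift D eta X A ->
  A = (X, - D eta.1 X (const_ext eta.1 eta.2)).
Proof.
move=> [gamma [V /= [[etaE XE] /nbhs_singleton [_ sl] _ /nbhs_singleton cV <-]]].
have {sl} dl := differentiableP (smooth_near_differentiable sl).
set lift : R -> TM := fun t => (gamma t, V t).
rewrite /velocity deriveE; last by have [] := dl.
rewrite [LHS]surjective_pairing; congr (_, _).
  rewrite -XE /velocity.
  have [d1 E1] := is_diff_comp dl (is_diff_fst (local_curve lift 0 0)).
  transitivity ('d (fst \o local_curve lift 0) 0 1); first by rewrite E1.
  by rewrite -deriveE.
have [d2 E2] := is_diff_comp dl (is_diff_snd (local_curve lift 0 0)).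
transitivity ('d (snd \o local_curve lift 0) 0 1); first by rewrite E2.
rewrite -deriveE //; move: cV; rewrite /cov_along XE -etaE /=.
by move=> /eqP; rewrite addr_eq0 => /eqP.
Qed.

End lifts.

Section sasakian.
Context {R : realType} {E : normedModType R} {n : nat} (bE : finite_basis E n).
Context {M : charted E} (hM : is_manifold M).
Let aM := manifold_atlas hM.
Let aTM := tangent_atlas bE hM.
Local Notation base p := (chart_map (chart_at p) p).
Local Notation TM := (tangent_bundle M).
Implicit Types (p q : M) (zeta eta : TM).
Variables (g : M -> E -> E -> R) (D : M -> E -> (M -> E) -> E).
Hypotheses (hg : riemannian_metric g) (hD : affine_connection D).
Variables (hl : TM -> E -> (E * E)%type) (gt : TM -> (E * E)%type -> (E * E)%type -> R).
Hypotheses (hhl : horizontal_lift D hl) (hgt : sasakian_metric g hl gt).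

(** The projection on the vertical space along the horizontal one: horizontal
    vectors are those of the form [(a, - Gamma(a, y))]. *)
Definition vertical_part zeta (A : (E * E)%type) : E :=
  A.2 + D zeta.1 A.1 (const_ext zeta.1 zeta.2).

(** A vector is the sum of the horizontal lift of its first component and of the
    vertical lift of its vertical part. *)
Lemma sasakianE zeta (A B : (E * E)%type) :
  gt zeta A B = g zeta.1 A.1 B.1 + g zeta.1 (vertical_part zeta A) (vertical_part zeta B).
Proof.
have [rgt gtl] := hgt.
have split_ (C : (E * E)%type) : C = hl zeta C.1 + vertical_lift zeta (vertical_part zeta C).
  rewrite (vertical_liftE aM) (horizontal_liftE (hhl zeta C.1)).
  rewrite /vertical_part [LHS]surjective_pairing.
  by congr (_, _) => /=; rewrite ?addr0 // addrCA addNr addr0.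
have [_ hh _] := gtl zeta A.1 B.1.
have [vv _ _] := gtl zeta (vertical_part zeta A) (vertical_part zeta B).
have [_ _ vh] := gtl zeta (vertical_part zeta A) B.1.
have [_ _ vh'] := gtl zeta (vertical_part zeta B) A.1.
rewrite {1}(split_ A) {1}(split_ B) (metricDl rgt) !(metricDr rgt) hh vv vh.
by rewrite (Defs.metric_sym rgt) vh' addr0 add0r.
Qed.

Lemma near_tangent_base eta : \forall z \near base eta,
  chart_dom (chart_at eta.1) (chart_inv (chart_at eta.1) z.1) /\
  chart_map (chart_at eta.1) (chart_inv (chart_at eta.1) z.1) = z.1.
Proof.
have nc : \forall x \near (base eta).1,
    chart_dom (chart_at eta.1) (chart_inv (chart_at eta.1) x) /\
    chart_map (chart_at eta.1) (chart_inv (chart_at eta.1) x) = x.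
  exact: (near_chart_at aM).
exact: near_fst nc.
Qed.

(** The coefficients of the Sasakian metric, near [eta] in one chart, expressed
    through the metric and the Christoffel symbols of [M]; the Koszul formula only
    needs their first derivatives. *)
Lemma sasakian_coef eta (A B : (E * E)%type) : let p := eta.1 in
  \forall z \near base eta, metric_coef gt eta A B z =
    metric_coef g p A.1 B.1 z.1
    + metric_coef g p (A.2 + christoffel D p A.1 z.2 z.1)
        (B.2 + christoffel D p B.1 z.2 z.1) z.1.
Proof.
move=> p; apply: filterS2 (near_tangent_base eta) (near_chart_at aTM eta).
move=> z [cz zE] [_ zE2].
rewrite -{1}zE2; set zeta : TM := chart_inv _ z.
have cz' : chart_dom (chart_at eta.1) zeta.1 by [].
have hz (C : (E * E)%type) : vertical_part zeta (const_ext eta C zeta) =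
    const_ext p (C.2 + christoffel D p C.1 z.2 z.1) zeta.1.
  rewrite /vertical_part (tangent_const_ext_vertical bE hM _ hD cz').
  by rewrite -[in RHS]zE2.
have hz1 (C : (E * E)%type) : (const_ext eta C zeta).1 = const_ext p C.1 zeta.1.
  by rewrite (tangent_const_extE bE hM _ cz').
rewrite /metric_coef /local_fun -/zeta.
have -> : chart_inv (chart_at eta) (chart_map (chart_at eta) zeta) = zeta.
  exact: (atlas_mapK aTM).
by rewrite sasakianE !hz !hz1.
Qed.

Lemma metric_deriv_sasakian p xi (A B C : (E * E)%type) :
  let eta : TM := (p, xi) in
  let al := vertical_part eta in
  let dG a u := 'd (christoffel D p a xi) (base p) u in
  let dg a b u := 'd (metric_coef g p a b) (base p) u in
  metric_deriv gt eta C A B =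
  dg A.1 B.1 C.1
  + (dg (al A) (al B) C.1
     + g p (al A) (dG B.1 C.1 + D p B.1 (const_ext p C.2))
     + g p (dG A.1 C.1 + D p A.1 (const_ext p C.2)) (al B)).
Proof.
move=> eta al dG dg.
have bE' : base eta = (base p, xi) by rewrite /= components_chart_at.
have hf := is_diff_fst (base p, xi); have hs := is_diff_snd (base p, xi).
have d1 : is_diff (base p, xi) (fun z => metric_coef g p A.1 B.1 z.1)
    (fun w => dg A.1 B.1 w.1).
  have H : is_diff ((base p, xi).1) (metric_coef g p A.1 B.1) (dg A.1 B.1).
    exact/differentiableP/smooth_near_differentiable/smooth_metric_coef.
  exact: (is_diff_comp hf H).
have da (F : (E * E)%type) : is_diff (base p, xi)
    (fun z => F.2 + christoffel D p F.1 z.2 z.1)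
    (fun w => dG F.1 w.1 + D p F.1 (const_ext p w.2)).
  have H := is_diff_christoffel bE hM F.1 hD (erefl : (base p, xi).1 = base p) hf hs.
  apply: (is_diff_eq (is_diffD (is_diff_cst F.2 (base p, xi)) H)).
  by apply/funext => w; rewrite !fctE /= add0r (christoffel_base hM).
have H := is_diff_metric_coef bE hg (differentiable_metric_coef hM hg p) hf (da A) (da B).
have [dd ddE] := is_diffD d1 H.
rewrite /metric_deriv /dirder.
have nn := sasakian_coef eta A B; rewrite bE' in nn *.
have [d3 E3] : is_diff (base p, xi) (metric_coef gt eta A B)
    ('d ((fun z => metric_coef g p A.1 B.1 z.1) +
      (fun z => metric_coef g p (A.2 + christoffel D p A.1 z.2 z.1)
        (B.2 + christoffel D p B.1 z.2 z.1) z.1)) (base p, xi)).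
  apply: near_is_diff (differentiableP dd).
  by apply: filterS nn => z ->.
transitivity ('d (metric_coef gt eta A B) (base p, xi) C); first by [].
rewrite E3 ddE !fctE /=.
by rewrite !(christoffel_base hM) !(metric_coef_base hM).
Qed.

End sasakian.

(** * Fields tangent to the sphere bundle *)

Section sphere_fields.
Context {R : realType} {E : normedModType R} {n : nat} (bE : finite_basis E n).
Context {M : charted E} (hM : is_manifold M).
Let aM := manifold_atlas hM.
Let aTM := tangent_atlas bE hM.
Local Notation base p := (chart_map (chart_at p) p).
Local Notation TM := (tangent_bundle M).
Local Notation tmap c := (@chart_map R (E * E)%type TM c).
Local Notation tinv c := (@chart_inv R (E * E)%type TM c).
Implicit Types (p q : M) (zeta eta : TM) (A B : (E * E)%type).
Variables (g : M -> E -> E -> R) (hg : riemannian_metric g).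
Variables (r : R) (r0 : 0 < r).

Definition square_length zeta : R := g zeta.1 zeta.2 zeta.2.

Lemma near_square_length eta :
  \forall z \near base eta,
    local_fun eta square_length z = metric_coef g eta.1 z.2 z.2 z.1.
Proof.
apply: filterS (near_tangent_base hM eta) => z [cz zE].
by rewrite /local_fun /square_length /= /metric_coef /local_fun /const_ext zE.
Qed.

Lemma smooth_square_length eta : smooth_fun_at eta square_length.
Proof.
set p := eta.1.
apply: (@eq_smooth_near _ _ _ (fun z => \sum_i basis_coord bE i z.2 *:
  \sum_j basis_coord bE j z.2 *:
    metric_coef g p (basis_vec bE i) (basis_vec bE j) z.1 : R^o)).
  apply: filterS (near_square_length eta) => z ->.
  by rewrite [RHS](metric_coef_expand bE hg).
have sc i : smooth_near (fun z : (E * E)%type => basis_coord bE i z.2) (base eta).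
  apply: smooth_near_linear => [a u v|z] /=; first by rewrite basis_coord_linear.
  apply: continuous_comp; first exact: snd_continuous.
  exact: basis_coord_continuous.
apply: smooth_near_sum => i; apply: smooth_nearZ => //.
apply: smooth_near_sum => j; apply: smooth_nearZ => //.
apply: (smooth_near_comp bE).
  by apply: smooth_near_linear; [exact: fst_linear|exact: fst_continuous].
exact: smooth_metric_coef.
Qed.

(** Half of the derivative of the squared length: its zeros are the vectors
    tangent to the sphere bundle. *)
Definition radial_rate eta B (z : (E * E)%type) : R :=
  2^-1 * 'D_B (local_fun eta square_length) z.

(** The second fundamental form is evaluated on fields that are tangent to the
    sphere bundle at each of its points.  [sphere_field] corrects a coordinate
    field by a multiple of the radial field [(0, y)] where the squared length is
    differentiable in the chart, and is zero at the other points. *)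
Definition sphere_field_good eta zeta :=
  chart_dom (chart_at eta.1) zeta.1 /\
  differentiable (local_fun eta square_length) (tmap (chart_at eta.1) zeta).

Definition sphere_correction eta B (z : (E * E)%type) : (E * E)%type :=
  B - (r ^- 2 * radial_rate eta B z) *: (0, z.2).

Definition sphere_field eta B : TM -> (E * E)%type := fun zeta =>
  if `[< sphere_field_good eta zeta >] then
    const_ext eta (sphere_correction eta B (tmap (chart_at eta.1) zeta)) zeta
  else 0.

Lemma tangent_to0 zeta : sphere_bundle g r zeta -> tangent_to (sphere_bundle g r) zeta 0.
Proof.
move=> Sz; exists (fun=> zeta); split => //.
- rewrite /derivable_curve_at; split; last exact: derivable_cst.
  by near=> s; exact: (atlas_chart_at aTM).
- by near=> s.
- exact: derive_cst.
Unshelve. all: by end_near. Qed.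

(** A line in the chart, rescaled so as to have length [r], is a curve in the
    sphere bundle.  The derivative of the scaling factor gives the correction
    term of [sphere_correction]. *)
Lemma sphere_field_tangent eta B zeta : sphere_bundle g r zeta ->
  tangent_to (sphere_bundle g r) zeta (sphere_field eta B zeta).
Proof.
move=> Sz; rewrite /sphere_field; case: ifPn => [/asboolP|_]; last exact: tangent_to0.
set c := chart_at eta.1; set z := tmap c zeta; set F := local_fun eta square_length.
move=> [cz dF].
have zK : tinv c z = zeta by exact: (atlas_mapK aTM).
have Fz : F z = r ^+ 2 by rewrite /F /local_fun -/c zK.
pose h (t : R^o) : R^o := F (z + t *: B).
have z0 : z + (0 : R^o) *: B = z by rewrite scale0r addr0.
have dh : is_diff (0 : R^o) h (fun t => 'd F z (t *: B)).
  have H : is_diff (z + (0 : R^o) *: B) F ('d F z) by rewrite z0; exact: differentiableP.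
  exact: (is_diff_comp (is_diff_line z B 0) H).
have h0 : h 0 = r ^+ 2 by rewrite /h z0.
pose lam (t : R^o) : R^o := r / Num.sqrt (h t).
have lam0 : lam 0 = 1.
  by rewrite /lam h0 sqrtr_sqr gtr0_norm // divff // gt_eqF.
have dlam := is_diff_normalize r0 h0 dh.
pose sig (t : R^o) : (E * E)%type := (z.1 + t *: B.1, lam t *: (z.2 + t *: B.2)).
have dsig := is_diff_pair (is_diff_line z.1 B.1 0) (is_diffZ_fun dlam (is_diff_line z.2 B.2 0)).
have sig0 : sig 0 = z.
  by rewrite /sig lam0 !scale0r !addr0 scale1r -surjective_pairing.
pose gamma (t : R) : TM := tinv c (sig t).
have gamma0 : gamma 0 = zeta by rewrite /gamma sig0.
have csig : {for (0 : R^o), continuous sig}.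
  by apply: differentiable_continuous; case: dsig.
have ndom : \forall t \near (0 : R^o), chart_dom (chart_at zeta.1) (gamma t).1.
  have nn : \forall y \near sig 0, @chart_dom R _ TM (chart_at zeta) (tinv c y).
    rewrite sig0; apply: filterS (near_overlap aTM (cz : @chart_dom R _ TM c zeta)
      (atlas_chart_at aTM zeta)) => y [_ dy _].
    exact: dy.
  exact: (csig _ nn).
have dT := is_diff_tangent_transition bE hM cz (atlas_chart_at aM zeta.1).
have dT' : is_diff (sig 0) (tmap (chart_at zeta.1) \o tinv c)
    ('d (tmap (chart_at zeta.1) \o tinv c) z).
  by rewrite sig0; apply: differentiableP; case: dT.
have dloc := is_diff_comp dsig dT'.
have locE : local_curve gamma 0 = (tmap (chart_at zeta.1) \o tinv c) \o sig.
  by apply/funext => t; rewrite /local_curve gamma0.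
exists gamma; split; first exact: gamma0.
- rewrite /derivable_curve_at locE gamma0; split; first exact: ndom.
  by apply: diff_derivable; case: dloc.
- have ch : {for (0 : R^o), continuous h}.
    by apply: differentiable_continuous; case: dh.
  have nh : \forall t \near (0 : R^o), 0 < h t.
    have nn : \forall y \near h 0, 0 < y.
      by rewrite h0; apply: lt_nbhsr; rewrite exprn_gt0.
    exact: (ch _ nn).
  apply: filterS nh => t ht.
  have -> : sphere_bundle g r (gamma t) = (lam t * (lam t * h t) = r ^+ 2).
    rewrite /sphere_bundle /= /gamma /= /h /F /local_fun /square_length /=.
    by rewrite linearZ (metricZl hg) (metricZr hg).
  rewrite /lam; have hs : Num.sqrt (h t) ^+ 2 = h t by rewrite sqr_sqrtr // ltW.
  rewrite -{3}hs; field.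
  by rewrite gt_eqF // sqrtr_gt0.
- rewrite /velocity locE deriveE; last by case: dloc.
  have [_ ->] := dloc; rewrite /= -/z.
  rewrite /const_ext -/c; congr ('d _ _ _).
  rewrite /sphere_correction /radial_rate deriveE // -/F.
  rewrite /lam in lam0 *; rewrite lam0 !scale1r scale0r addr0.
  rewrite [LHS]surjective_pairing [RHS]surjective_pairing; congr (_, _) => /=.
    by rewrite scaler0 subr0.
  rewrite -scaleNr; congr (_ + _ *: _).
  have -> : (2 * r ^+ 2)^-1 = r ^- 2 * 2^-1 by rewrite invfM mulrC.
  by rewrite mulNr mulrA.
Qed.

End sphere_fields.

Section sphere_second_form.
Context {R : realType} {E : normedModType R} {n : nat} (bE : finite_basis E n).
Context {M : charted E} (hM : is_manifold M).
Let aM := manifold_atlas hM.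
Let aTM := tangent_atlas bE hM.
Local Notation base p := (chart_map (chart_at p) p).
Local Notation TM := (tangent_bundle M).
Local Notation tmap c := (@chart_map R (E * E)%type TM c).
Local Notation tinv c := (@chart_inv R (E * E)%type TM c).
Implicit Types (p q : M) (zeta eta : TM) (A B : (E * E)%type).
Variables (g : M -> E -> E -> R) (Dg : M -> E -> (M -> E) -> E).
Hypotheses (hg : riemannian_metric g) (hDg : levi_civita g Dg).
Variables (r : R) (r0 : 0 < r).

(** Since [Dg] is metric, the derivative of [g(y, y)] along [(b1, b2)] is
    [2 g(b2 + Gamma^g(b1, y), y)]. *)
Lemma near_radial_rate eta B : let p := eta.1 in
  \forall z \near base eta, radial_rate g eta B z =
    metric_coef g p (B.2 + christoffel Dg p B.1 z.2 z.1) z.2 z.1.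
Proof.
move=> p; set F := local_fun eta (square_length g).
have nF := near_square_length hM g eta.
have nd : \forall x \near (base eta).1, forall a b, differentiable (metric_coef g p a b) x.
  exact: (near_differentiable_metric_coef bE hM hg p).
have nc := near_tangent_base hM eta.
apply: filterS2 (near_fst nd) (filterI (near_join nF) nc).
move=> z dz [/= nFz [cz zE]].
have := is_diff_metric_coef bE hg dz (is_diff_fst z) (is_diff_snd z) (is_diff_snd z).
have nFz' : \near z, metric_coef g p z.2 z.2 z.1 = F z.
  by apply: filterS nFz => w <-.
move=> /(near_is_diff nFz') [dF FE].
rewrite /radial_rate deriveE // FE.
have H := @diff_metric_coef _ _ _ bE _ hM g Dg hDg p _ z.2 z.2 B.1 cz.
rewrite /= zE in H; rewrite (H (dz _ _)).
rewrite (metric_coefC hg p z.2 B.2) (metric_coefC hg p z.2 (christoffel _ _ _ _ _)).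
rewrite -[X in metric_coef g p (X + _)](scale1r B.2) (metric_coef_linearl hg).
rewrite /GRing.scale /= mul1r.
by field.
Qed.

Lemma tangent_base p xi : base ((p, xi) : TM) = (base p, xi).
Proof. by rewrite /= components_chart_at. Qed.

Lemma radial_rate_base p xi B : radial_rate g ((p, xi) : TM) B (base ((p, xi) : TM)) =
  g p (B.2 + Dg p B.1 (const_ext p xi)) xi.
Proof.
rewrite (nbhs_singleton (near_radial_rate (p, xi) B)) tangent_base /=.
by rewrite (metric_coef_base hM) (christoffel_base hM).
Qed.

Lemma diff_radial_rate p xi A B : let eta : TM := (p, xi) in
  let be := B.2 + Dg p B.1 (const_ext p xi) in
  'd (radial_rate g eta B : (E * E)%type -> R^o) (base eta) A =
  'd (metric_coef g p be xi) (base p) A.1 + g p be A.2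
  + g p ('d (christoffel Dg p B.1 xi) (base p) A.1 + Dg p B.1 (const_ext p A.2)) xi.
Proof.
move=> eta be; have [aDg _ _] := hDg.
have hf := is_diff_fst (base p, xi); have hs := is_diff_snd (base p, xi).
have H := is_diff_christoffel bE hM B.1 aDg (erefl : (base p, xi).1 = base p) hf hs.
have H1 := is_diffD (is_diff_cst B.2 (base p, xi)) H.
have H2 := is_diff_metric_coef bE hg (differentiable_metric_coef hM hg p) hf H1 hs.
have nr := near_radial_rate eta B.
have nr' : \forall z \near (base p, xi), metric_coef g p
    ((cst B.2 + (fun y => christoffel Dg p B.1 y.2 y.1)) z) z.2 z.1 = radial_rate g eta B z.
  by rewrite -tangent_base; apply: filterS nr => z ->.
have [_ dE] := near_is_diff nr' H2.
transitivity ('d (radial_rate g eta B : (E * E)%type -> R^o) (base p, xi) A).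
  by rewrite tangent_base.
by rewrite dE !fctE /= !(metric_coef_base hM) !(christoffel_base hM) add0r.
Qed.

Lemma smooth_radial_rate eta B :
  smooth_near (radial_rate g eta B : (E * E)%type -> R^o) (base eta).
Proof.
apply: (@smooth_nearZ _ _ R^o (fun=> 2^-1)); first exact: smooth_near_cst.
exact/smooth_near_derive/(smooth_square_length bE hM hg).
Qed.

Lemma near_sphere_field eta B : \forall z \near base eta,
  sphere_field g r eta B (tinv (chart_at eta.1) z) =
  const_ext eta (sphere_correction g r eta B z) (tinv (chart_at eta.1) z).
Proof.
have nd := smooth_near_is_near (smooth_square_length bE hM hg eta).
apply: filterS2 (near_chart_at aTM eta) nd => z [cz zE] sz.
rewrite /sphere_field; case: ifPn => [_|/asboolPn[]]; first by rewrite zE.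
split; first exact: cz.
by rewrite zE; exact: smooth_near_differentiable.
Qed.

Lemma local_sphere_field eta B : \forall z \near base eta,
  local_field eta (sphere_field g r eta B) z = sphere_correction g r eta B z.
Proof.
apply: filterS2 (near_chart_at aTM eta) (near_sphere_field eta B) => z [cz zE] sz.
by rewrite /local_field sz (components_const_ext aTM).
Qed.

Lemma smooth_snd_part (z : (E * E)%type) :
  smooth_near (fun z => (0, z.2) : (E * E)%type) z.
Proof.
apply: smooth_near_linear => [a u v|].
  by rewrite [RHS]surjective_pairing; congr (_, _) => //=; rewrite scaler0 addr0.
move=> y; apply: cvg_pair; first exact: cvg_cst.
exact: (@snd_continuous _ E E y).
Qed.

Lemma smooth_correction_coef eta B :
  smooth_near (fun z => - (r ^- 2 * radial_rate g eta B z) : R^o) (base eta).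
Proof.
rewrite (_ : (fun z => _) = (fun z => (- r ^- 2 : R^o) *: (radial_rate g eta B z : R^o))).
  by apply: smooth_nearZ; [exact: smooth_near_cst|exact: smooth_radial_rate].
by apply/funext => z; rewrite -mulNr.
Qed.

Lemma smooth_sphere_field eta B : smooth_field_at eta (sphere_field g r eta B).
Proof.
apply: (@eq_smooth_near _ _ _ (fun z => B +
   (- (r ^- 2 * radial_rate g eta B z) : R^o) *: ((0, z.2) : (E * E)%type))).
  by apply: filterS (local_sphere_field eta B) => z ->; rewrite /sphere_correction scaleNr.
apply: smooth_nearD; first exact: smooth_near_cst.
apply: smooth_nearZ; first exact: smooth_correction_coef.
exact: smooth_snd_part.
Qed.

Lemma sphere_field_base eta B : radial_rate g eta B (base eta) = 0 ->
  sphere_field g r eta B eta = B.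
Proof.
move=> rB; rewrite -(local_field_at aTM) (nbhs_singleton (local_sphere_field eta B)).
by rewrite /sphere_correction rB mulr0 scale0r subr0.
Qed.

(** The coefficient of the radial correction vanishes at [eta], so only its
    derivative contributes, and the derivative of the radial field does not
    appear. *)
Lemma conn_sphere_field (Dt : TM -> (E * E)%type -> (TM -> (E * E)%type) -> (E * E)%type)
    eta A B : affine_connection Dt -> radial_rate g eta B (base eta) = 0 ->
  Dt eta A (sphere_field g r eta B) = Dt eta A (const_ext eta B)
    - (r ^- 2 * 'd (radial_rate g eta B : (E * E)%type -> R^o) (base eta) A) *: (0, eta.2).
Proof.
move=> hDt rB; set c := chart_at eta.1.
pose nu (zeta : TM) : (E * E)%type := const_ext eta (0, (tmap c zeta).2) zeta.
pose psi (zeta : TM) : R := - (r ^- 2 * radial_rate g eta B (tmap c zeta)).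
have nc := near_chart_at aTM eta.
have snu : smooth_field_at eta nu.
  apply: (@eq_smooth_near _ _ _ (fun z => (0, z.2) : (E * E)%type));
    last exact: smooth_snd_part.
  apply: filterS nc => z [cz zE].
  by rewrite /local_field (components_const_ext aTM _ cz) zE.
have npsi : \forall z \near base eta,
    - (r ^- 2 * radial_rate g eta B z) = local_fun eta psi z.
  by apply: filterS nc => z [cz zE]; rewrite /local_fun /psi zE.
have spsi : smooth_fun_at eta psi.
  exact: eq_smooth_near npsi (smooth_correction_coef eta B).
have sB := smooth_const_ext aTM eta B.
have -> : Dt eta A (sphere_field g r eta B) =
    Dt eta A (fun zeta => const_ext eta B zeta + psi zeta *: nu zeta).
  apply: (conn_local aTM hDt).
  - exact: smooth_sphere_field.
  - by apply: smooth_fieldD => //; exact: smooth_fieldZ.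
  - apply: filterS2 nc (near_sphere_field eta B) => z [cz zE] ->.
    rewrite /nu /psi zE /sphere_correction /const_ext linearB linearZ.
    by rewrite scaleNr.
rewrite (conn_add hDt) //; last exact: smooth_fieldZ.
rewrite (conn_leibniz hDt) //.
have -> : psi eta = 0 by rewrite /psi -/(base eta) rB mulr0 oppr0.
rewrite scale0r addr0; congr (_ + _); rewrite -scaleNr; congr (_ *: _); last first.
  by rewrite /nu (const_ext_self aTM) /= (components_chart_at aM).
rewrite /dirder.
have ds := differentiableP (smooth_near_differentiable (smooth_radial_rate eta B)).
have npsi' : \forall z \near base eta,
    ((- r ^- 2) *: (radial_rate g eta B : (E * E)%type -> R^o)) z = local_fun eta psi z.
  by apply: filterS npsi => z <-; rewrite -mulNr.
have [_ ->] := near_is_diff npsi' (is_diffZ (- r ^- 2) ds).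
by rewrite -mulNr.
Qed.

End sphere_second_form.

(** * The identity at a point *)

Section pointwise_identity.
Context {R : realFieldType} {E : lmodType R}.
Variables (g : E -> E -> R) (Gam K : E -> E -> E) (dGam dK : E -> E -> E) (y : E).
Hypotheses (g_linear : forall a u v w, g (a *: u + v) w = a * g u w + g v w)
  (gC : forall u v, g u v = g v u).
Hypotheses (Gam_linear : forall a u v w, Gam w (a *: u + v) = a *: Gam w u + Gam w v)
  (GamC : forall u v, Gam u v = Gam v u).
Hypotheses (K_linear : forall a u v w, K w (a *: u + v) = a *: K w u + K w v)
  (KC : forall u v, K u v = K v u) (gK : forall u v w, g (K u v) w = g (K u w) v).
Hypotheses (dGamNl : forall u v, dGam (- u) v = - dGam u v)
  (dGamNr : forall u v, dGam u (- v) = - dGam u v).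

Let gD u v w : g (u + v) w = g u w + g v w.
Proof. by rewrite -{1}[u]scale1r g_linear mul1r. Qed.
Let gN u w : g (- u) w = - g u w.
Proof.
have g0 : g 0 w = 0 by have := g_linear (-1) 0 0 w; rewrite scaler0 addr0 => E0; lra.
by rewrite -[- u]addr0 -scaleN1r g_linear g0; lra.
Qed.
Let gDr u v w : g w (u + v) = g w u + g w v.
Proof. by rewrite gC gD !(gC w). Qed.
Let gNr u w : g w (- u) = - g w u.
Proof. by rewrite gC gN (gC w). Qed.

Let additive_expand (F : E -> E -> E) :
  (forall a u v w, F w (a *: u + v) = a *: F w u + F w v) ->
  (forall u v w, F w (u + v) = F w u + F w v) /\ (forall u w, F w (- u) = - F w u).
Proof.
move=> lF; have F1 u v w : F w (u + v) = F w u + F w v.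
  by rewrite -{1}[u]scale1r lF scale1r.
split => // u w; apply: (@addrI _ (F w u)); rewrite -F1 !subrr.
by apply: (@addrI _ (F w 0)); rewrite -F1 !addr0.
Qed.
Let GD := (additive_expand Gam_linear).1.
Let GN := (additive_expand Gam_linear).2.
Let KD := (additive_expand K_linear).1.
Let KN := (additive_expand K_linear).2.
Let GDl u v w : Gam (u + v) w = Gam u w + Gam v w.
Proof. by rewrite GamC GD !(GamC w). Qed.
Let GNl u w : Gam (- u) w = - Gam u w.
Proof. by rewrite GamC GN (GamC w). Qed.
Let KDl u v w : K (u + v) w = K u w + K v w.
Proof. by rewrite KC KD !(KC w). Qed.
Let KNl u w : K (- u) w = - K u w.
Proof. by rewrite KC KN (KC w). Qed.
Let expandE := (gD, gN, gDr, gNr, GD, GN, GDl, GNl, KD, KN, KDl, KNl, dGamNl, dGamNr).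

Let k := K y y.

(** In this section [Gam] and [K] are the values at a point of the Christoffel
    symbols and of the difference tensor; [dGam b u] and [dK b u] stand for the
    derivatives along [u] of the components of [Gam b y] and [K b y].
    [metric_rate u a b] is the derivative along [u] of the metric coefficient of
    [a] and [b], by [D g = - 2 K]. *)
Definition metric_rate u a b : R := g (Gam u a) b + g a (Gam u b) - 2 * g (K u a) b.

(** The covariant derivative of [K] for the metric connection, at [(y, y)]. *)
Definition diff_tensor_rate u : E :=
  dK y u + (Gam u k - K u k) - K (Gam u y - K u y) y - K y (Gam u y - K u y).

Definition curvature_expr u v : E :=
  (dGam v u + Gam u (Gam v y)) - (dGam u v + Gam v (Gam u y)).

(** Derivative along [(u, w)] of the coefficient of the Sasakian metric on two
    constant vectors with horizontal parts [a], [b] and vertical parts [al], [be]. *)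
Definition sasakian_rate u w a al b be : R :=
  metric_rate u a b + (metric_rate u al be
    + g al (dGam b u + Gam b w) + g (dGam a u + Gam a w) be).

(** Derivative along [(a, w)] of the radial rate of the constant vector with
    horizontal part [b] and vertical part [be]. *)
Definition radial_second a w b be : R :=
  metric_rate a (be - K b y) y + g (be - K b y) w
  + g (dGam b a - dK b a + (Gam b w - K b w)) y.

Hypothesis dK_sym : forall u b,
  metric_rate u k b + g (dK y u) b = metric_rate u (K y b) y + g (dK b u) y.

(** Total symmetry of the derivative of [K] moves [b] from the last argument to
    the first one, where it meets the derivatives of the radial rate. *)
Lemma diff_tensor_rateE u b :
  g (diff_tensor_rate u) b = g (dK b u) y + g (Gam u (K b y)) y
    - g (K b (Gam u y)) y - g (Gam u b) k + g (K u b) k.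
Proof.
have := dK_sym u b; rewrite /diff_tensor_rate /metric_rate !expandE.
rewrite (KC y b) (KC (Gam u y)) (KC (K u y)).
rewrite (gC k (Gam u b)) (gC (K b y) (Gam u y)) (gK u k b).
rewrite (gK y (Gam u y) b) (gK y (K u y) b) (KC y b) (gK b (Gam u y) y).
rewrite (gK u (K b y) y) (gC (K u y) (K b y)) (gC (Gam u y) (K b y)) => H.
by lra.
Qed.

(** The left-hand side is the Koszul formula for the normal vector, whose
    horizontal and vertical parts are [- k] and [y], together with the
    contribution of the radial correction.  The Christoffel symbols
    recombine into the curvature of [D].  The remaining derivatives of [Gam] are
    [g (dGam b a) y] and [g (dGam a b) y], and they are eliminated by the
    hypothesis, which expresses that second derivatives of the squared length
    commute. *)
Lemma second_form_identity a al b be :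
  let wa := al - Gam a y in let wb := be - Gam b y in
  radial_second a wa b be = radial_second b wb a al ->
  2^-1 * (sasakian_rate a wa b be (- k) y + sasakian_rate b wb a al (- k) y
          - sasakian_rate (- k) (y + Gam k y) a al b be)
  - radial_second a wa b be =
  2^-1 * (g (diff_tensor_rate a) b + g (diff_tensor_rate b) a)
  - 2 * g (K y a) (K y b)
  + (g (K a be) y - 2^-1 * g (curvature_expr a k) be)
  + (g (K b al) y - 2^-1 * g (curvature_expr b k) al)
  - g al be - g (K al be) k.
Proof.
move=> wa wb; rewrite !diff_tensor_rateE.
rewrite /radial_second /sasakian_rate /curvature_expr /metric_rate /wa /wb.
rewrite !expandE => H.
(* The symmetries of [g], [Gam] and [K] identify the monomials of both sides. *)
have e u v de :
    [/\ g v (Gam u k) = g (Gam k u) v, g v (Gam k u) = g (Gam k u) v,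
        g de (Gam u y) = g (Gam u y) de, g (K v y) (Gam u y) = g (K v (Gam u y)) y &
        g (Gam u y) (K v y) = g (K v (Gam u y)) y].
  split; [by rewrite (GamC u k) gC|by rewrite gC|by rewrite gC|by rewrite gK|].
  by rewrite gC gK.
have e' u ga de :
    [/\ g de (dGam k u) = g (dGam k u) de, g de (dGam u k) = g (dGam u k) de,
        g de (Gam k ga) = g (Gam k ga) de,
        g de (Gam k (Gam u y)) = g (Gam k (Gam u y)) de &
        g de (Gam u (Gam k y)) = g (Gam u (Gam k y)) de].
  by split; rewrite gC.
have e'' u v ga :
    [/\ g (K k u) v = g (K u v) k, g (K v y) ga = g (K v ga) y,
       g (K k al) be = g (K al be) k & g (K u (K v y)) y = g (K y u) (K y v)].
  split; [by rewrite (KC k) gK|by rewrite gK|by rewrite (KC k) gK|].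
  by rewrite gK (KC u y) (KC v y).
have [x1 x2 x3 x4 x5] := e a b be.
have [y1 y2 y3 y4 y5] := e b a al.
have [z1 z2 z3 z4 z5] := e' a al be.
have [t1 t2 t3 t4 t5] := e' b be al.
have [u1 u2 u3 u4] := e'' a b al.
have [v1 v2 v3 v4] := e'' b a be.
have w1 : g be al = g al be by rewrite gC.
have w2 : g (K y b) (K y a) = g (K y a) (K y b) by rewrite gC.
rewrite (GamC a b) (KC a b) in H u1 *.
by lra.
Qed.

End pointwise_identity.

(** * The second fundamental form of the sphere bundle *)

Section sphere_bundle_form.
Context {R : realType} {E : normedModType R} {n : nat} (bE : finite_basis E n).
Context {M : charted E} (hM : is_manifold M).
Let aM := manifold_atlas hM.
Let aTM := tangent_atlas bE hM.
Local Notation base p := (chart_map (chart_at p) p).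
Local Notation TM := (tangent_bundle M).
Variables (g : M -> E -> E -> R) (D Dg : M -> E -> (M -> E) -> E).
Hypotheses (hstat : statistical_structure g D) (hLC : levi_civita g Dg).
Variables (hl : TM -> E -> (E * E)%type) (gt : TM -> (E * E)%type -> (E * E)%type -> R).
Hypotheses (hhl : horizontal_lift D hl) (hgt : sasakian_metric g hl gt).
Variable (Dt : TM -> (E * E)%type -> (TM -> (E * E)%type) -> (E * E)%type).
Hypothesis (hLCt : levi_civita gt Dt).
Variables (r : R) (r0 : 0 < r) (p : M) (y : E) (hy : g p y y = r ^+ 2).
Let eta : TM := (p, y).
Let Gam u v := D p u (const_ext p v).
Let K := diff_tensor D Dg p.
Let dGam b u := 'd (christoffel D p b y) (base p) u.
Let dK b u := ddiff_christoffel D Dg p u b y.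
Let k := K y y.

Let rg : riemannian_metric g. Proof. by case: hstat. Qed.
Let aD : affine_connection D. Proof. by case: hstat. Qed.
Let aDg : affine_connection Dg. Proof. by case: hLC. Qed.

Let gC u v : g p u v = g p v u. Proof. exact: (Defs.metric_sym rg). Qed.
Let g_linear a u v w : g p (a *: u + v) w = a * g p u w + g p v w.
Proof. exact: (metric_linear rg). Qed.
Let GamC u v : Gam u v = Gam v u.
Proof. by have [_ _ tf _] := hstat; exact: (torsion_free_const_ext aM p u v tf). Qed.
Let Gam_linear a u v w : Gam w (a *: u + v) = a *: Gam w u + Gam w v.
Proof. exact: (conn_const_extP bE hM _ _ _ _ aD (atlas_chart_at aM p)). Qed.
Let Gam0l v : Gam 0 v = 0.
Proof. by apply: (conn_along0 aD); exact: (smooth_const_ext aM). Qed.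
Let GamNl u v : Gam (- u) v = - Gam u v.
Proof.
rewrite -[- u]addr0 -scaleN1r /Gam (conn_linear aD); last exact: (smooth_const_ext aM).
by rewrite -/(Gam 0 v) Gam0l addr0 scaleN1r.
Qed.
Let KC u v : K u v = K v u. Proof. exact: (diff_tensorC hM hstat hLC). Qed.
Let gK u v w : g p (K u v) w = g p (K u w) v.
Proof. exact: (metric_diff_tensor hM hstat hLC). Qed.
Let K_linear a u v w : K w (a *: u + v) = a *: K w u + K w v.
Proof.
rewrite /K /diff_tensor -/(Gam w (a *: u + v)) Gam_linear.
rewrite (conn_const_extP bE hM _ _ _ _ aDg (atlas_chart_at aM p)).
by rewrite scalerBr opprD addrACA.
Qed.

Let LC_Gam u v : Dg p u (const_ext p v) = Gam u v - K u v.
Proof. by rewrite /K /diff_tensor subKr. Qed.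

Lemma diff_christoffel_linearl u : linear (fun b => dGam b u).
Proof.
move=> s b c; rewrite /dGam.
have dd e := differentiableP (smooth_near_differentiable (smooth_christoffel hM p e y aD)).
have nn : \forall x \near base p, (s *: christoffel D p b y + christoffel D p c y) x =
    christoffel D p (s *: b + c) y x.
  apply: filterS (near_base_dom hM p) => x cx.
  by rewrite (christoffel_linearl bE hM y aD cx).
have H := near_is_diff_unique nn (is_diffD (is_diffZ s (dd b)) (dd c)) (dd _).
exact: (esym (congr1 (fun F => F u) H)).
Qed.

Let dGam0l u : dGam 0 u = 0.
Proof.
have := diff_christoffel_linearl u (-1) 0 0.
by rewrite scaler0 addr0 scaleN1r addNr.
Qed.
Let dGamNl u v : dGam (- u) v = - dGam u v.
Proof.
have := diff_christoffel_linearl v (-1) u 0.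
by rewrite !scaleN1r !addr0 dGam0l addr0.
Qed.
Let dGamNr u v : dGam u (- v) = - dGam u v. Proof. exact: linearN. Qed.

Let metric_rateE u a b :
  'd (metric_coef g p a b) (base p) u = metric_rate (g p) Gam K u a b.
Proof.
have H := diff_metric_coef bE hM hLC (p := p) (q := p) u (atlas_chart_at aM p)
  (differentiable_metric_coef hM rg p a b).
rewrite H !(christoffel_base hM) !(metric_coef_base hM) !LC_Gam.
rewrite /metric_rate (metricBl rg) (metricBr rg) (gC a (K u b)) (gK u b a).
by ring.
Qed.

Let dK_sym u b : metric_rate (g p) Gam K u k b + g p (dK y u) b =
  metric_rate (g p) Gam K u (K y b) y + g p (dK b u) y.
Proof.
rewrite -!metric_rateE /dK.
have := metric_ddiff_christoffel bE hM hstat hLC p u y y b.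
by rewrite (ddiff_christoffelC bE hM hstat hLC p u y b).
Qed.

(** The tangent vector at [(p, y)] with horizontal part [a] and vertical part [al]. *)
Definition lifted a al : (E * E)%type := (a, al - Gam a y).

Let vertical_lifted a al : vertical_part D eta (lifted a al) = al.
Proof. by rewrite /vertical_part /lifted /= subrK. Qed.

Let lifted_radial a al : radial_rate g eta (lifted a al) (base eta) =
  g p (al - K a y) y.
Proof.
rewrite (radial_rate_base bE hM rg hLC) /= LC_Gam.
by rewrite addrA subrK.
Qed.

Let diff_radial a al b be :
  'd (radial_rate g eta (lifted b be) : (E * E)%type -> R^o) (base eta) (lifted a al) =
  radial_second (g p) Gam K dGam dK y a (al - Gam a y) b be.
Proof.
rewrite (diff_radial_rate bE hM rg hLC) /= !LC_Gam addrA subrK.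
rewrite /radial_second metric_rateE; congr (_ + _ + g p (_ + _) _).
by rewrite /dK /ddiff_christoffel /dGam subKr.
Qed.

Let metric_deriv_lifted u w a al b be :
  metric_deriv gt eta (u, w) (lifted a al) (lifted b be) =
  sasakian_rate (g p) Gam K dGam u w a al b be.
Proof.
rewrite (metric_deriv_sasakian bE hM rg aD hhl hgt) !vertical_lifted /=.
by rewrite !metric_rateE.
Qed.

Variable (h : TM -> (E * E)%type -> (E * E)%type -> R).
Hypothesis (hh : second_fundamental_form gt Dt (sphere_bundle g r)
  (sphere_normal g (diff_tensor D Dg) hl r) h).
Let c := (Num.sqrt (r ^+ 2 + metric_norm g p k ^+ 2))^-1.

(** The four formulas at once: tangential and vertical lifts are the vectors with
    parts [(u, s *: y)] and [(0, u)]. *)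
Lemma second_form_lifted a al b be :
  g p (al - K a y) y = 0 -> g p (be - K b y) y = 0 ->
  h eta (lifted a al) (lifted b be) = c *
  (2^-1 * (g p (diff_tensor_rate Gam K dK y a) b + g p (diff_tensor_rate Gam K dK y b) a)
  - 2 * g p (K y a) (K y b)
  + (g p (K a be) y - 2^-1 * g p (curvature_expr Gam dGam y a k) be)
  + (g p (K b al) y - 2^-1 * g p (curvature_expr Gam dGam y b k) al)
  - g p al be - g p (K al be) k).
Proof.
move=> ta tb; have [rgt _] := hgt; have [aDt _ _] := hLCt.
have Seta : sphere_bundle g r eta by [].
have ra := etrans (lifted_radial a al) ta; have rb := etrans (lifted_radial b be) tb.
set A := lifted a al in ra *; set B := lifted b be in rb *.
have tanA : tangent_to (sphere_bundle g r) eta A.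
  have := sphere_field_tangent bE hM rg r0 eta A Seta.
  by rewrite (sphere_field_base bE hM rg r ra).
have := hh Seta tanA (smooth_sphere_field bE hM rg r eta B)
  (fun _ Sz => sphere_field_tangent bE hM rg r0 eta B Sz).
rewrite (sphere_field_base bE hM rg r rb) => ->.
rewrite (conn_sphere_field bE hM rg r A aDt rb).
have NE : sphere_normal g (diff_tensor D Dg) hl r eta = c *: lifted (- k) y.
  rewrite /sphere_normal /eta /= -/K -/k -/c; congr (_ *: _).
  rewrite (vertical_liftE aM) (horizontal_liftE (hhl _ _)) /=.
  rewrite /lifted [LHS]surjective_pairing; congr (_, _) => /=; first by rewrite add0r.
  by rewrite GamNl.
rewrite NE (metricZr rgt) (metricBl rgt) (metricZl rgt) diff_radial.
have gnu : gt eta (0, y) (lifted (- k) y) = r ^+ 2.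
  rewrite (sasakianE hM hhl hgt) vertical_lifted /vertical_part /=.
  by rewrite -/(Gam 0 y) Gam0l addr0 hy gC (metric0r rg) add0r.
rewrite gnu; congr (_ * _).
(* Both sides are mixed second derivatives of the squared length. *)
have sym : radial_second (g p) Gam K dGam dK y a (al - Gam a y) b be =
    radial_second (g p) Gam K dGam dK y b (be - Gam b y) a al.
  rewrite -!diff_radial -/A -/B.
  have dr C C' : 'd (radial_rate g eta C : (E * E)%type -> R^o) (base eta) C' =
      2^-1 * 'D_C' ('D_C (local_fun eta (square_length g))) (base eta).
    have sC : smooth_near ('D_C (local_fun eta (square_length g))) (base eta).
      exact/smooth_near_derive/(smooth_square_length bE hM rg).
    have [_ /= dE] := is_diffZ (2^-1) (differentiableP (smooth_near_differentiable sC)).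
    rewrite deriveE; last exact: smooth_near_differentiable.
    exact: (congr1 (fun F => F C') dE).
  have sw := derive_swap A B (smooth_square_length bE hM rg eta).
  transitivity (2^-1 * 'D_A ('D_B (local_fun eta (square_length g))) (base eta)).
    exact: dr.
  transitivity (2^-1 * 'D_B ('D_A (local_fun eta (square_length g))) (base eta)).
    by rewrite sw.
  by symmetry; exact: dr.
rewrite -(second_form_identity g_linear gC Gam_linear GamC K_linear KC gK
  dGamNl dGamNr dK_sym sym).
have kz := koszul aTM rgt hLCt eta A B (lifted (- k) y).
have rn0 : r != 0 by rewrite gt_eqF.
(* The Koszul formula gives twice the inner product. *)
have -> : gt eta (Dt eta A (const_ext eta B)) (lifted (- k) y) =
  2^-1 * (2 * gt eta (Dt eta A (const_ext eta B)) (lifted (- k) y)) by field.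
rewrite kz !metric_deriv_lifted.
have -> : y - Gam (- k) y = y + Gam k y by rewrite GamNl opprK.
by field.
Qed.

Let cov_tensor_rate u :
  cov_tensor Dg (diff_tensor D Dg) p u y y = diff_tensor_rate Gam K dK y u.
Proof. by rewrite (cov_tensorE bE hM p u y y aD aDg) /diff_tensor_rate !LC_Gam. Qed.

Let curvature_rate u : curvature D p u k y = curvature_expr Gam dGam y u k.
Proof. by rewrite (curvatureE bE hM p u k y aD). Qed.

Let K0l u : K 0 u = 0.
Proof. by have := K_linear (-1) 0 0 u; rewrite KC scaler0 addr0 scaleN1r addNr. Qed.
Let K0r u : K u 0 = 0. Proof. by rewrite KC K0l. Qed.
Let g0r u : g p u 0 = 0. Proof. exact: metric0r. Qed.
Let g0l u : g p 0 u = 0. Proof. by rewrite gC g0r. Qed.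

Let curvature_rate0 u : curvature_expr Gam dGam y 0 u = 0.
Proof.
have d0 : dGam u 0 = 0 by exact: linear0.
by rewrite /curvature_expr d0 dGam0l !Gam0l GamC Gam0l !addr0 subrr.
Qed.

Let KZ u a v : K u (a *: v) = a *: K u v.
Proof. by rewrite -[a *: v]addr0 K_linear K0r addr0. Qed.

Let KZl u a v : K (a *: v) u = a *: K v u.
Proof. by rewrite KC KZ KC. Qed.

Let diff_tensor_rate0 : diff_tensor_rate Gam K dK y 0 = 0.
Proof.
have d0 : dK y 0 = 0 by rewrite /dK /ddiff_christoffel !linear0 addr0.
by rewrite /diff_tensor_rate d0 !(Gam0l, K0l, K0r, subr0, addr0).
Qed.

(** The multiple of [y] is the one that makes the radial rate vanish. *)
Lemma tangential_liftE u : tangential_lift g (diff_tensor D Dg) hl r eta u =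
  lifted u ((r ^- 2 * g p k u) *: y).
Proof.
rewrite /tangential_lift /eta /= -/K -/k (vertical_liftE aM) (horizontal_liftE (hhl _ _)).
rewrite /lifted [LHS]surjective_pairing; congr (_, _) => /=.
  by rewrite scaler0 addr0.
by rewrite addrC.
Qed.

Lemma vertical_lift_lifted u : vertical_lift eta u = lifted 0 u.
Proof. by rewrite (vertical_liftE aM) /lifted Gam0l subr0. Qed.

Let tangential_radial u : g p ((r ^- 2 * g p k u) *: y - K u y) y = 0.
Proof.
rewrite (metricBl rg) (metricZl rg) hy (KC u y) gK -/k mulrAC.
by rewrite mulVf ?mul1r ?subrr // expf_neq0 // gt_eqF.
Qed.

Let vertical_radial u : g p u y = 0 -> g p (u - K 0 y) y = 0.
Proof. by rewrite K0l subr0. Qed.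

Let K_vertical u : g p (K u y) y = g p k u. Proof. by rewrite KC gK. Qed.

Let norm_k : metric_norm g p k ^+ 2 = g p k k.
Proof.
rewrite /metric_norm sqr_sqrtr //.
have [->|/(metric_pos rg) /ltW //] := eqVneq k 0; by rewrite g0r.
Qed.

Let th := tangential_lift g (diff_tensor D Dg) hl r eta.
Let vl := @vertical_lift R E M eta.
Let DK u := cov_tensor Dg (diff_tensor D Dg) p u y y.
Let Rm := curvature D p.

Lemma second_form_th_th u v : h eta (th u) (th v) =
  c * (2^-1 * (g p (DK u) v + g p (DK v) u)
       - (2 * r ^+ 2)^-1 * (g p k v * g p (Rm u k y) y + g p k u * g p (Rm v k y) y)
       - 2 * g p (K y u) (K y v)
       + r ^- 2 * g p k u * g p k v * (1 - r ^- 2 * metric_norm g p k ^+ 2)).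
Proof.
rewrite /th !tangential_liftE second_form_lifted //; congr (_ * _).
rewrite /DK /Rm !cov_tensor_rate !curvature_rate norm_k.
rewrite !(KZ, KZl) !(metricZl rg) !(metricZr rg) !K_vertical hy -/k.
by field; rewrite gt_eqF.
Qed.

Lemma second_form_th_vl u v : g p v y = 0 -> h eta (th u) (vl v) =
  c * (g p (K u v) y - 2^-1 * g p (Rm u k y) v - r ^- 2 * g p k u * g p (K y v) k).
Proof.
move=> vy; rewrite /th /vl tangential_liftE vertical_lift_lifted.
rewrite second_form_lifted //; last exact: vertical_radial.
congr (_ * _); rewrite /Rm !curvature_rate curvature_rate0.
rewrite g0r g0l K0r g0r K0l g0l.
rewrite diff_tensor_rate0 g0l (metricZl rg) (gC y v) vy KZl (metricZl rg).
by ring.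
Qed.

Lemma second_form_vl_th u v : g p u y = 0 -> h eta (vl u) (th v) =
  c * (g p (K u v) y - 2^-1 * g p (Rm v k y) u - r ^- 2 * g p k v * g p (K y u) k).
Proof.
move=> uy; rewrite /th /vl tangential_liftE vertical_lift_lifted.
rewrite second_form_lifted //; last exact: vertical_radial.
congr (_ * _); rewrite /Rm !curvature_rate curvature_rate0.
rewrite g0r g0l K0r g0l K0l g0l.
rewrite diff_tensor_rate0 g0l (metricZr rg) uy KZ (metricZl rg) (KC v u) (KC u y).
by ring.
Qed.

Lemma second_form_vl_vl u v : g p u y = 0 -> g p v y = 0 ->
  h eta (vl u) (vl v) = c * (- g p u v - g p (K u v) k).
Proof.
move=> uy vy; rewrite /vl !vertical_lift_lifted.
rewrite second_form_lifted; try exact: vertical_radial.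
congr (_ * _); rewrite !g0r K0r g0l !K0l !curvature_rate0 !g0l.
by ring.
Qed.

End sphere_bundle_form.

Unset Implicit Arguments.

Lemma row_coord_linear {R : realType} n i : linear ((fun u => u 0 i) : 'rV[R]_n -> R^o).
Proof. by move=> a u v; rewrite !mxE. Qed.

Definition row_basis (R : realType) (n : nat) : finite_basis 'rV[R]_n n :=
  @FiniteBasis R 'rV[R]_n n (fun i => delta_mx 0 i) (fun i u => u 0 i)
    (row_coord_linear n) (fun i => @coord_continuous _ _ _ 0 i)
    (fun v => row_sum_delta v).

Theorem proposition3p3 (R : realType) (n : nat)
    (M : charted 'rV[R]_n) (hM : is_manifold M)
    (g : M -> 'rV[R]_n -> 'rV[R]_n -> R)
    (nabla nablag : M -> 'rV[R]_n -> (M -> 'rV[R]_n) -> 'rV[R]_n)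
    (hstat : statistical_structure g nabla)
    (hLC : levi_civita g nablag)
    (hl : tangent_bundle M -> 'rV[R]_n -> ('rV[R]_n * 'rV[R]_n)%type)
    (hhl : horizontal_lift nabla hl)
    (gt : tangent_bundle M -> ('rV[R]_n * 'rV[R]_n)%type ->
          ('rV[R]_n * 'rV[R]_n)%type -> R)
    (hgt : sasakian_metric g hl gt)
    (nablat : tangent_bundle M -> ('rV[R]_n * 'rV[R]_n)%type ->
          (tangent_bundle M -> ('rV[R]_n * 'rV[R]_n)%type) ->
          ('rV[R]_n * 'rV[R]_n)%type)
    (hLCt : levi_civita gt nablat)
    (r : R) (hr : 0 < r)
    (h : tangent_bundle M -> ('rV[R]_n * 'rV[R]_n)%type ->
         ('rV[R]_n * 'rV[R]_n)%type -> R)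
    (hh : second_fundamental_form gt nablat (sphere_bundle g r)
            (sphere_normal g (diff_tensor nabla nablag) hl r) h)
    (p : M) (xi : 'rV[R]_n) (hxi : g p xi xi = r ^+ 2) :
  let K := diff_tensor nabla nablag in
  let DK := cov_tensor nablag K p in
  let Rm := curvature nabla p in
  let Kxi := K p xi xi in
  let c := (Num.sqrt (r ^+ 2 + metric_norm g p Kxi ^+ 2))^-1 in
  let th := tangential_lift g K hl r (p, xi) in
  let vl := @vertical_lift R 'rV[R]_n M (p, xi) in
  let hS := h (p, xi) in
  [/\ forall X Y : 'rV[R]_n,
        hS (th X) (th Y) =
        c * (2^-1 * (g p (DK X xi xi) Y + g p (DK Y xi xi) X)
             - (2 * r ^+ 2)^-1 * (g p Kxi Y * g p (Rm X Kxi xi) xi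
                                  + g p Kxi X * g p (Rm Y Kxi xi) xi)
             - 2 * g p (K p xi X) (K p xi Y)
             + r ^- 2 * g p Kxi X * g p Kxi Y
               * (1 - r ^- 2 * metric_norm g p Kxi ^+ 2)),
      forall X Y : 'rV[R]_n, g p Y xi = 0 ->
        hS (th X) (vl Y) =
        c * (g p (K p X Y) xi
             - 2^-1 * g p (Rm X Kxi xi) Y
             - r ^- 2 * g p Kxi X * g p (K p xi Y) Kxi),
      forall X Y : 'rV[R]_n, g p X xi = 0 ->
        hS (vl X) (th Y) =
        c * (g p (K p X Y) xi
             - 2^-1 * g p (Rm Y Kxi xi) X
             - r ^- 2 * g p Kxi Y * g p (K p xi X) Kxi) &
      forall X Y : 'rV[R]_n, g p X xi = 0 -> g p Y xi = 0 ->
        hS (vl X) (vl Y) =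
        c * (- g p X Y - g p (K p X Y) Kxi)].
Proof.
move=> K DK Rm Kxi c th vl hS.
have bE := row_basis R n.
split=> X Y.
- exact: (second_form_th_th bE hM hstat hLC hhl hgt hLCt hr hxi hh).
- exact: (second_form_th_vl bE hM hstat hLC hhl hgt hLCt hr hxi hh).
- exact: (second_form_vl_th bE hM hstat hLC hhl hgt hLCt hr hxi hh).
- exact: (second_form_vl_vl bE hM hstat hLC hhl hgt hLCt hr hxi hh).
Qed.
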